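(* Let $\mathcal{A}$ be a unital $*$-algebra, $\mathcal{H}$ a Hilbert space, and let $T:\mathcal{A}\to\mathcal{L}(\mathcal{H})$ be a linear hermitian map. Let $K_T(x,y)=T(xy^* )$ for $x,y\in\mathcal{A}$, and let $\phi(a,x)=xa^*$ for $a,x\in\mathcal{A}$. The following assertions are equivalent: (1) There exists a positive definite kernel $L\in\mathcal{B}_\phi^+(\mathcal{A},\mathcal{H})$ such that $-L\le K_T\le L$. (2) $T$ has a minimal Stinespring dilation.
   Context: $\mathcal{L}(\cdot,\cdot)$ denotes bounded linear operators. A linear map $T:\mathcal{A}\to\mathcal{L}(\mathcal{H})$ is hermitian if $T(a^* )=T(a)^*$ for all $a$. A Kreĭn space is an indefinite inner product space $(\mathcal{K},[\cdot,\cdot]_{\mathcal{K}})$ for which there is a positive inner product $\langle\cdot,\cdot\rangle$ making $\mathcal{K}$ a Hilbert space and an operator $J$ with $J^*=J^{-1}=J$ such that $[\xi,\eta]=\langle J\xi,\eta\rangle$; $J$ is called a fundamental symmetry. Topological notions and $*$-adjoints refer to this Hilbert space structure; for $R\in\mathcal{L}(\mathcal{K})$, $R^\sharp=JR^*J$. A set is total if its linear span is dense. A Stinespring dilation of $T$ is a triplet $(\pi,\mathcal{K},B)$ where $\mathcal{K}$ is a Kreĭn space with a fundamental symmetry $J$, $B\in\mathcal{L}(\mathcal{H},\mathcal{K})$, and $\pi:\mathcal{A}\to\mathcal{L}(\mathcal{K})$ is a selfadjoint representation (that is, $\pi(a^* )=\pi(a)^\sharp=J\pi(a)^*J$ for all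 $a$) such that $T(a)=B^*J\pi(a)B$ for all $a\in\mathcal{A}$. It is minimal if $\{\pi(a)B\mathcal{H}\mid a\in\mathcal{A}\}$ is total in $\mathcal{K}$. Let $X$ be a set. A kernel $K:X\times X\to\mathcal{L}(\mathcal{H})$ is hermitian if $K(x,y)=K(y,x)^*$. $\mathcal{F}_0(X,\mathcal{H})$ is the space of finitely supported functions $X\to\mathcal{H}$, and $[f,g]_K=\sum_{x,y\in X}\langle K(x,y)f(y),g(x)\rangle$. A hermitian kernel $L$ is positive definite if $[f,f]_L\ge0$ for all $f$; for hermitian kernels, $A\le B$ means $[f,f]_A\le[f,f]_B$ for all $f\in\mathcal{F}_0(X,\mathcal{H})$. Here $\phi$ is regarded as an action on the set $X=\mathcal{A}$ of the multiplicative semigroup $\mathcal{A}$ with involution $*$. For $a\in\mathcal{A}$, let $\psi_a$ be the linear map on $\mathcal{F}_0(\mathcal{A},\mathcal{H})$ with $\psi_a(\xi_x)=\xi_{\phi(a,x)}$, where $\xi_x$ is the function equal to $\xi\in\mathcal{H}$ at $x$ and $0$ elsewhere. A positive definite kernel $L$ on $\mathcal{A}$ is $\phi$-bounded if for every $a\in\mathcal{A}$ the map $\psi_a$ is bounded with respect to the seminorm $f\mapsto[f,f]_L^{1/2}$. $\mathcal{B}_\phi^+(\mathcal{A},\mathcal{H})$ is the set of positive definite $\phi$-bounded kernels on $\mathcal{A}$ with values in $\mathcal{L}(\mathcal{H})$. *)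

(* Defs.v *)
From HB Require Import structures.
From mathcomp Require Import all_boot all_order all_algebra.
From mathcomp Require Import ring lra complex finmap.
From mathcomp Require Import all_classical all_reals.
From mathcomp Require Import topology normedtype.

Set Implicit Arguments.
Unset Strict Implicit.
Unset Printing Implicit Defensive.

Import Order.TTheory GRing.Theory Num.Theory.
Import numFieldNormedType.Exports.

Local Open Scope classical_set_scope.
Local Open Scope ring_scope.

HB.mixin Record isStarAlgebra (R : realType) A of GRing.Algebra R[i] A := {
  star : A -> A;
  starP : forall (c : R[i]) (a b : A),
    star (c *: a + b) = c^* *: star a + star b;
  starM : forall a b : A, star (a * b) = star b * star a;
  starK : involutive star }.

#[short(type="starAlgType")]
HB.structure Definition StarAlgebra (R : realType) :=
  {A of isStarAlgebra R A & GRing.Algebra R[i] A}.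

(* A [{dot H for Num.conj}] is linear in its first argument and antilinear in
   its second; [hdotxx] makes the given (complete) norm the one it induces. *)
HB.mixin Record isHilbert (R : realType) H of CompleteNormedModule R[i] H := {
  hdot : {dot H for Num.conj};
  hdotxx : forall x : H, hdot x x = `|x| ^+ 2 }.

#[short(type="hilbertType")]
HB.structure Definition Hilbert (R : realType) :=
  {H of isHilbert R H & CompleteNormedModule R[i] H}.

Notation "'[< x , y >]" := (hdot x y) : ring_scope.

Section RealPart.
Context {R : realType} (H : hilbertType R).
Implicit Types (x y z : H) (t : R).

Lemma ReD (a b : R[i]) : complex.Re (a + b) = complex.Re a + complex.Re b.
Proof. by case: a b => [a a'] [b b']. Qed.
Lemma ReN (a : R[i]) : complex.Re (- a) = - complex.Re a.
Proof. by case: a. Qed.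
Lemma ReZ t (a : R[i]) : complex.Re (t%:C%C * a) = t * complex.Re a.
Proof. by case: a => a b /=; rewrite mul0r subr0. Qed.

Lemma real_complexM (s t : R) : (s * t)%:C%C = s%:C%C * t%:C%C.
Proof. exact: rmorphM. Qed.
Lemma ltr0c t : (0 < t%:C%C) = (0 < t).
Proof. exact: (ltcR 0 t). Qed.

Let rd x y := complex.Re '[<x, y>].
Let nr x := complex.Re `|x|.

Lemma Rnorm x : `|x| = (nr x)%:C%C.
Proof. by rewrite /nr RRe_real// normr_real. Qed.

Lemma hdotC x y : '[<x, y>] = ('[<y, x>])^*.
Proof. by rewrite [LHS]hermC expr0 mul1r. Qed.

Lemma hdotPr (c : R[i]) x y z :
  '[<z, c *: x + y>] = c^* * '[<z, x>] + '[<z, y>].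
Proof. by rewrite linearPr. Qed.

Let rdC x y : rd x y = rd y x.
Proof. by rewrite /rd hdotC; case: '[<y, x>]. Qed.
Let rdDl x y z : rd (x + y) z = rd x z + rd y z.
Proof. by rewrite /rd linearDl ReD. Qed.
Let rdNl x z : rd (- x) z = - rd x z.
Proof. by rewrite /rd linearNl ReN. Qed.
Let rdZl t x z : rd (t%:C%C *: x) z = t * rd x z.
Proof. by rewrite /rd linearZl_LR ReZ. Qed.
Let rdDr x y z : rd z (x + y) = rd z x + rd z y.
Proof. by rewrite rdC rdDl !(rdC z). Qed.
Let rdZr t x z : rd z (t%:C%C *: x) = t * rd z x.
Proof. by rewrite rdC rdZl rdC. Qed.
Let rdxx x : rd x x = nr x ^+ 2.
Proof. by rewrite /rd hdotxx Rnorm -rmorphXn. Qed.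
Lemma Re_norm_ge0 x : 0 <= complex.Re `|x|.
Proof. by rewrite -ler0c -[_%:C%C]Rnorm normr_ge0. Qed.

Let nr_ge0 x : 0 <= nr x. Proof. exact: Re_norm_ge0. Qed.

Lemma Re_hdot_le x y : complex.Re '[<x, y>] <= complex.Re `|x| * complex.Re `|y|.
Proof.
rewrite -/(rd x y) -/(nr x) -/(nr y).
have h0 (z w : H) : nr z = 0 -> rd z w = 0.
  move=> z0; have /eqP: `|z| = 0 by rewrite Rnorm z0.
  by rewrite normr_eq0 => /eqP ->; rewrite /rd linear0l.
have := nr_ge0 x; rewrite le0r => /orP[/eqP x0|xp].
  by rewrite h0 // x0 mul0r.
have := nr_ge0 y; rewrite le0r => /orP[/eqP y0|yp].
  by rewrite rdC h0 // y0 mulr0.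
have := sqr_ge0 (nr ((nr y)%:C%C *: x + (- nr x)%:C%C *: y)).
rewrite -rdxx !(rdDl, rdDr, rdZl, rdZr) !rdxx (rdC y x) => h.
have : 0 <= (nr x * nr y) * (nr x * nr y - rd x y) by nra.
by rewrite pmulr_rge0 ?mulr_gt0// subr_ge0.
Qed.

Lemma riesz (phi : {scalar H}) (C : R) :
  (forall x, complex.Re (phi x) <= C * complex.Re `|x|) ->
  exists u, forall x, phi x = '[<x, u>].
Proof.
move=> phiC.
pose f x := complex.Re (phi x).
have fD x y : f (x + y) = f x + f y by rewrite /f linearD ReD.
have fZ t x : f (t%:C%C *: x) = t * f x by rewrite /f linearZ ReZ.
pose J x := nr x ^+ 2 - 2 * f x.
have JD x v t : J (x + t%:C%C *: v)
    = J x + t ^+ 2 * nr v ^+ 2 + 2 * t * (rd x v - f v).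
  rewrite /J fD fZ -!rdxx !(rdDl, rdDr, rdZl, rdZr) (rdC v x); ring.
have Jb x : - C ^+ 2 <= J x.
  rewrite /J; have := phiC x; rewrite -/(f x) -/(nr x) => h.
  by have := sqr_ge0 (nr x - C); nra.
pose m := inf (range J).
have Jinf : has_inf (range J).
  by split; [exists (J 0), 0|exists (- C ^+ 2) => _ [x _ <-]; exact: Jb].
have mJ x : m <= J x by apply: ge_inf; [case: Jinf|exists x].
pose F : set_system H := filter_from [set e : R | 0 < e] (fun e => [set x | J x < m + e]).
have FF : ProperFilter F.
  apply: filter_from_proper; last first.
    move=> e e0; have [_ [x _ <-] h] := inf_adherent e0 Jinf.
    by exists x.
  apply: filter_from_filter; first by exists 1 => /=.
  move=> e e' e0 e'0; exists (Num.min e e') => /=; first by rewrite lt_min e0.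
  by move=> x /=; rewrite -ltrBlDl lt_min !ltrBlDl => /andP[].
have par x y e : J x < m + e -> J y < m + e -> nr (x - y) ^+ 2 <= 4 * e.
  move=> hx hy.
  have E : y = x + (1:R)%:C%C *: (y - x) by rewrite scale1r addrC subrK.
  have h1 := JD x (y - x) 1; rewrite -E in h1.
  have h2 := JD x (y - x) (2^-1).
  have := mJ (x + (2^-1)%:C%C *: (y - x)); rewrite h2.
  have -> : nr (x - y) = nr (y - x) by rewrite /nr distrC.
  move: h1; set a := nr _ ^+ 2; set b := rd _ _ - _; set Jx := J x in hx *.
  set Jy := J y in hy *.
  clearbody a b Jx Jy; clear -hx hy; lra.
have cF : cauchy F.
  apply: cauchy_exP => e e0.
  have [r r0 eE] : exists2 r : R, 0 < r & e = r%:C%C.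
    by exists (complex.Re e); [rewrite -ltr0c RRe_real ?gtr0_real|rewrite RRe_real ?gtr0_real].
  have r8 : 0 < r ^+ 2 / 8 by rewrite divr_gt0// exprn_gt0.
  have [_ [x _ <-] h] := inf_adherent r8 Jinf.
  exists x, (r ^+ 2 / 8) => //= y /= hy.
  rewrite -ball_normE /= eE Rnorm ltcR.
  have := par _ _ _ h hy => {}h.
  rewrite -(@ltr_pXn2r _ 2) ?nnegrE ?nr_ge0 ?(ltW r0)//.
  by apply: le_lt_trans h _; have := exprn_gt0 2 r0; lra.
have /cvg_ex[/= u Fu] : cvg F by apply: cauchy_cvg.
exists u.
suff key v : f v = rd u v.
  move=> v; apply/eqP; rewrite eq_complex; apply/andP; split; apply/eqP.
    by rewrite -[LHS]/(f v) key rdC.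
  have := key ('i%C *: v); rewrite rdC /f /rd linearZ linearZl_LR /=.
  by case: (phi v) '[<v, u>] => a b [c d] /=; rewrite !mul0r !mul1r !sub0r => /oppr_inj.
pose b := rd u v - f v.
have : forall e, 0 < e -> forall t, 0 <= t ^+ 2 * nr v ^+ 2 + 2 * t * b + e * (1 + 2 * `|t| * nr v).
  move=> e e0 t.
  have [x [hx xu]] : exists x, J x < m + e /\ nr (u - x) < e.
    have Fb : F [set x | J x < m + e] by exists e.
    have Fc : F [set x | nr (u - x) < e].
      have /= := Fu (ball u e%:C%C) _.
      move=> /(_ (nbhsx_ballx _ _ _)); rewrite ltr0c => /(_ e0).
      by apply: filterS => y; rewrite -ball_normE /= Rnorm ltcR.
    by have [x []] := filter_ex (filterI Fb Fc); exists x.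
  have := mJ (x + t%:C%C *: v); rewrite JD => h.
  have h1 : rd (x - u) (t%:C%C *: v) <= e * (`|t| * nr v).
    apply: le_trans (Re_hdot_le _ _) _.
    have -> : complex.Re `|t%:C%C *: v| = `|t| * nr v.
      by rewrite normrZ normc_def /= expr0n addr0 sqrtr_sqr ReZ.
    apply: ler_wpM2r; first by rewrite mulr_ge0 ?nr_ge0.
    by rewrite distrC ltW.
  have h2 : t * (rd x v - rd u v) = rd (x - u) (t%:C%C *: v).
    by rewrite rdZr rdDl rdNl.
  rewrite /b; move: h hx h1; rewrite -h2.
  set A := t ^+ 2 * _; set B := _ * (_ * nr v); set X := rd x v; set Y := rd u v.
  move=> h hx h1.
  have -> : A + 2 * t * (Y - f v) + e * (1 + 2 * `|t| * nr v) =
     (A + 2 * t * (X - f v)) - 2 * (t * (X - Y)) + e + 2 * B by rewrite /B; ring.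
  clearbody A B X Y; lra.
move=> h.
have h' t : 0 <= t ^+ 2 * nr v ^+ 2 + 2 * t * b.
  apply/ler_addgt0Pr => e e0.
  have p : 0 < 1 + 2 * `|t| * nr v by rewrite ltr_pwDl// !mulr_ge0 ?nr_ge0.
  by have := h (e / (1 + 2 * `|t| * nr v)) (divr_gt0 e0 p) t; rewrite divfK// gt_eqF.
suff b0 : b = 0 by move/eqP: b0; rewrite subr_eq0 => /eqP.
have p : 0 < 1 + nr v ^+ 2 by rewrite ltr_pwDl// sqr_ge0.
have := h' (- b / (1 + nr v ^+ 2)).
have -> : (- b / (1 + nr v ^+ 2)) ^+ 2 * nr v ^+ 2 + 2 * (- b / (1 + nr v ^+ 2)) * b
  = - (b ^+ 2 * (2 + nr v ^+ 2)) / (1 + nr v ^+ 2) ^+ 2.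
  by field; rewrite gt_eqF.
rewrite pmulr_lge0 ?invr_gt0 ?exprn_gt0// oppr_ge0 pmulr_lle0; last by lra.
by move=> b2; apply/eqP; rewrite -sqrf_eq0 eq_le b2 sqr_ge0.
Qed.
End RealPart.

Section BoundedOperators.
Context {R : realType} (U V : hilbertType R).

Definition bounded_linear : {pred U -> V} := fun f =>
  `[< linear f /\ exists M : R, forall x, `|f x| <= M%:C%C * `|x| >].

Lemma bounded_linear_submod : submod_closed bounded_linear.
Proof.
split=> [|c f g /asboolP[fl [M fM]] /asboolP[gl [N gN]]]; apply/asboolP.
  split=> [a x y|]; first by rewrite /= scaler0 addr0.
  by exists 0 => x; rewrite normr0 mul0r.
split=> [a x y|].
  rewrite !fctE fl gl !scalerDr !scalerA (mulrC c) -!addrA; congr (_ + _).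
  by rewrite addrCA.
exists (complex.Re `|c| * M + N) => x; rewrite !fctE.
have -> : (complex.Re `|c| * M + N)%:C%C = `|c| * M%:C%C + N%:C%C.
  by rewrite rmorphD rmorphM; congr (_ * _ + _); apply: RRe_real; rewrite normr_real.
by rewrite (le_trans (ler_normD _ _))// normrZ mulrDl -mulrA lerD ?ler_wpM2l.
Qed.

HB.instance Definition _ :=
  GRing.isSubmodClosed.Build R[i] (U -> V) bounded_linear bounded_linear_submod.

Record bop := Bop { bop_fun :> U -> V; bopP : bop_fun \in bounded_linear }.

HB.instance Definition _ := [isSub for bop_fun].
HB.instance Definition _ := [Choice of bop by <:].
HB.instance Definition _ := [SubChoice_isSubLmodule of bop by <:].

Lemma bop_linear (S : bop) : linear S.
Proof. by have /asboolP[] := bopP S. Qed.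

HB.instance Definition _ (S : bop) :=
  GRing.isLinear.Build R[i] U V _ (bop_fun S) (bop_linear S).

Lemma bop_bounded (S : bop) : exists M : R, forall x, `|S x| <= M%:C%C * `|x|.
Proof. by have /asboolP[] := bopP S. Qed.

Lemma bop_eqP (S1 S2 : bop) : S1 =1 S2 -> S1 = S2.
Proof. by move=> eqS; apply/val_inj/funext. Qed.
End BoundedOperators.

Section Composition.
Context {R : realType}.

Lemma bcomp_subproof (U V W : hilbertType R) (S : bop V W) (S' : bop U V) :
  S \o S' \in @bounded_linear _ U W.
Proof.
apply/asboolP; split=> [a x y|]; first by rewrite /= !linearP.
have [[M SM] [N SN]] := (bop_bounded S, bop_bounded S').
exists (`|M| * N) => x /=.
rewrite (le_trans (SM _))// (@le_trans _ _ (`|M|%:C%C * `|S' x|))//.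
  by rewrite ler_wpM2r// lecR ler_norm.
by rewrite real_complexM -mulrA ler_wpM2l// ler0c.
Qed.

Definition bcomp (U V W : hilbertType R) (S : bop V W) (S' : bop U V) :
  bop U W := Bop (bcomp_subproof S S').

Lemma bid_subproof (U : hilbertType R) : idfun \in @bounded_linear _ U U.
Proof.
by apply/asboolP; split=> [a x y//|]; exists 1 => x; rewrite mul1r.
Qed.

Definition bid (U : hilbertType R) : bop U U := Bop (bid_subproof U).
End Composition.

Notation "S \oB S'" := (bcomp S S')
  (at level 50, left associativity, format "S  \oB  S'") : ring_scope.

Section Adjoint.
Context {R : realType} {U V : hilbertType R}.

Lemma adjoint_exists (S : bop U V) :
  exists S' : bop V U, forall x y, '[<S x, y>] = '[<x, S' y>].
Proof.
have [M SM] := bop_bounded S.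
have Mge x : complex.Re `|S x| <= `|M| * complex.Re `|x|.
  rewrite -lecR real_complexM -!Rnorm (le_trans (SM x))//.
  by rewrite ler_wpM2r// lecR ler_norm.
have ex y : exists u, forall x, '[<S x, y>] = '[<x, u>].
  pose f (x : U) := '[<S x, y>].
  have fl : scalar f by move=> a x z; rewrite /f linearP linearPl.
  pose F := GRing.isLinear.Build _ _ _ _ f fl.
  pose phi : {scalar U} := HB.pack f F.
  apply: (@riesz _ _ phi (`|M| * complex.Re `|y|)) => x.
  rewrite (le_trans (Re_hdot_le _ _))// mulrAC ler_wpM2r ?Re_norm_ge0//.
have [g gE] := choice ex.
have hinj (u w : U) : (forall x, '[<x, u>] = '[<x, w>]) -> u = w.
  move=> /(_ (u - w)) /eqP; rewrite -subr_eq0 -linearBr => h.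
  have : `|u - w| ^+ 2 = 0 by rewrite -hdotxx; exact/eqP.
  by move/eqP; rewrite sqrf_eq0 normr_eq0 subr_eq0 => /eqP.
have gl : linear g.
  move=> a x y; apply: hinj => z.
  by rewrite -gE !hdotPr -!gE.
have gB : g \in @bounded_linear _ V U.
  apply/asboolP; split=> //; exists `|M| => y.
  rewrite (Rnorm (g y)) (Rnorm y) -real_complexM lecR.
  have h0 := Re_norm_ge0 (g y).
  have h1 : 0 <= `|M| * complex.Re `|y|.
    by rewrite mulr_ge0// Re_norm_ge0.
  have : complex.Re `|g y| ^+ 2 <= complex.Re `|g y| * (`|M| * complex.Re `|y|).
    have -> : complex.Re `|g y| ^+ 2 = complex.Re '[<g y, g y>].
      by rewrite hdotxx Rnorm -rmorphXn.
    rewrite -gE (le_trans (Re_hdot_le _ _))// mulrCA mulrA ler_wpM2r//.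
    exact: Re_norm_ge0.
  move: h0; rewrite le0r => /orP[/eqP->//|gp].
  by rewrite expr2 ler_pM2l.
by exists (Bop gB) => x y; exact: gE.
Qed.

(* Unique, since '[<x, u>] = '[<x, w>] for all x forces u = w. *)
Definition adjoint (S : bop U V) : bop V U := sval (cid (adjoint_exists S)).

Lemma adjointE (S : bop U V) x y : '[<S x, y>] = '[<x, adjoint S y>].
Proof. exact: (svalP (cid (adjoint_exists S))). Qed.
End Adjoint.

(* A Krein space together with a chosen fundamental symmetry [fsym] and the
   associated Hilbert space structure; [kdot] is the indefinite inner product.
   [fsym_adj] and [fsymK] say that J^* = J = J^-1. *)
Record kreinSpace (R : realType) := KreinSpace {
  krein_hilbert :> hilbertType R;
  kdot : krein_hilbert -> krein_hilbert -> R[i];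
  fsym : bop krein_hilbert krein_hilbert;
  fsym_adj : adjoint fsym = fsym;
  fsymK : fsym \oB fsym = bid krein_hilbert;
  kdotE : forall x y, kdot x y = '[<fsym x, y>] }.

Definition sharp (R : realType) (K : kreinSpace R) (S : bop K K) : bop K K :=
  fsym K \oB adjoint S \oB fsym K.

Definition lin_span (F : pzRingType) (V : lmodType F) (S : set V) : set V :=
  [set x | exists (n : nat) (c : 'I_n -> F) (v : 'I_n -> V),
    (forall i, S (v i)) /\ x = \sum_(i < n) c i *: v i].

Definition total (R : realType) (V : hilbertType R) (S : set V) : Prop :=
  dense (lin_span S).

Section Stinespring.
Context {R : realType} (A : starAlgType R) (H : hilbertType R).

Definition hermitian_map (T : A -> bop H H) :=
  forall a, T (star a) = adjoint (T a).

Definition selfadjoint_rep (K : kreinSpace R) (pi : A -> bop K K) :=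
  [/\ linear pi,
      forall a b, pi (a * b) = pi a \oB pi b
    & forall a, pi (star a) = sharp (pi a)].

Definition stinespring_dilation (T : A -> bop H H)
    (K : kreinSpace R) (pi : A -> bop K K) (B : bop H K) :=
  selfadjoint_rep pi /\
  forall a, T a = adjoint B \oB fsym K \oB pi a \oB B.

Definition minimal_dilation
    (K : kreinSpace R) (pi : A -> bop K K) (B : bop H K) :=
  total [set pi a (B h) | a in [set: A] & h in [set: H]].
End Stinespring.

Section Kernels.
Context {R : realType} (X : choiceType) (H : hilbertType R).
Implicit Types (K L : X -> X -> bop H H) (f g : X -> H).

Definition hermitian_kernel K := forall x y, K x y = adjoint (K y x).

Definition fin_supp : set (X -> H) :=
  [set f | finite_set [set x | f x != 0]].

(* The sums are finite for finitely supported [f] and [g]; [\sum_(x \in [set: X])]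
   ranges over the support of the summand (and is 0 when it is infinite). *)
Definition kform K f g : R[i] :=
  \sum_(x \in [set: X]) \sum_(y \in [set: X]) '[<K x y (f y), g x>].

(* In R[i], a <= b means that b - a is a nonnegative real; [kform K f f] is real
   when [K] is hermitian. *)
Definition kernel_le K L :=
  forall f, fin_supp f -> kform K f f <= kform L f f.

Definition posdef_kernel L :=
  hermitian_kernel L /\ forall f, fin_supp f -> 0 <= kform L f f.

Definition point_fun (x : X) (h : H) : X -> H :=
  fun y => if y == x then h else 0.

(* The linear extension of [point_fun x h |-> point_fun (phi a x) h], see
   [psi_point] and [psi_linear]; only meaningful on [fin_supp]. *)
Definition psi (S : Type) (phi : S -> X -> X) (a : S) (f : X -> H) : X -> H :=
  \sum_(x \in [set: X]) point_fun (phi a x) (f x).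

Lemma psi_finE (S : Type) (phi : S -> X -> X) a (D : {fset X}) f :
  (forall x, x \notin D -> f x = 0) ->
  psi phi a f = \sum_(x <- D) point_fun (phi a x) (f x).
Proof.
move=> fD; rewrite /psi (fsbigTE D)// => x /fD ->.
by apply/funext => y; rewrite /point_fun if_same.
Qed.

Lemma psi_point (S : Type) (phi : S -> X -> X) a x h :
  psi phi a (point_fun x h) = point_fun (phi a x) h.
Proof.
rewrite (@psi_finE _ _ _ [fset x]%fset).
  by rewrite big_seq_fset1 /point_fun eqxx.
by move=> y; rewrite inE /point_fun => /negPf ->.
Qed.

Lemma psi_linear (S : Type) (phi : S -> X -> X) a (c : R[i]) f g :
  fin_supp f -> fin_supp g ->
  psi phi a (c *: f + g) = c *: psi phi a f + psi phi a g.
Proof.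
move=> Ff Fg.
pose D := (fset_set [set x | f x != 0%R] `|` fset_set [set x | g x != 0%R])%fset.
have fD x : x \notin D -> f x = 0.
  apply: contraNeq => fx; rewrite in_fsetU in_fset_set//.
  by apply/orP; left; rewrite inE.
have gD x : x \notin D -> g x = 0.
  apply: contraNeq => gx; rewrite in_fsetU !in_fset_set//.
  by apply/orP; right; rewrite inE.
rewrite !(@psi_finE _ _ _ D)//; last first.
  by move=> x xD; rewrite !fctE fD// gD// scaler0 addr0.
rewrite scaler_sumr -big_split; apply: eq_bigr => x _ /=.
apply/funext => y; rewrite !fctE /point_fun; case: ifP => // _.
by rewrite scaler0 addr0.
Qed.

Definition phi_bounded (S : Type) (phi : S -> X -> X) L :=
  forall a : S, exists c : R, forall f, fin_supp f ->
    sqrtC (kform L (psi phi a f) (psi phi a f)) <= c%:C%C * sqrtC (kform L f f).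

Definition Bphi_plus (S : Type) (phi : S -> X -> X) : set (X -> X -> bop H H) :=
  [set L | posdef_kernel L /\ phi_bounded phi L].
End Kernels.

(* Main.v *)
Require Import Defs.
From HB Require Import structures.
From mathcomp Require Import all_boot all_order all_algebra.
From mathcomp Require Import ring lra complex finmap.
From mathcomp Require Import all_classical all_reals.
From mathcomp Require Import topology normedtype.

Set Implicit Arguments.
Unset Strict Implicit.
Unset Printing Implicit Defensive.

Import Order.TTheory GRing.Theory Num.Theory.
Import numFieldNormedType.Exports.

Local Open Scope classical_set_scope.
Local Open Scope ring_scope.

(** Write a' for the adjoint of a in A. Let V be the space of finitely
    supported functions A -> H, let k be the hermitian form on V given by the
    kernel T(x y'), and let psi_a be the operator on V that moves the point x to
    x a'. With respect to k, the operators psi_a and psi_a' are adjoint to each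
    other ([act_adjoint]).

    From a dilation to a majorant: put V_x = pi(x') B. Then T(x y') is
    V_x^* J V_y, and L(x, y) = V_x^* V_y is the majorant. Indeed the map
    v f = \sum_x V_x (f x) turns [f, f]_L into <v f, v f>, turns k(f, f) into
    <J (v f), v f>, and intertwines psi_a with pi(a); since J is isometric,
    |<J u, u>| <= <u, u> ([majorant_of_dilation]).

    From a majorant to a dilation: if L is replaced by a suitable smaller
    form, the Gram operator of k becomes a symmetry, and neither a square root
    nor a sign function of an operator has to be formed. Fix constants
    c_a = c_a' that bound psi_a for [., .]_L. Among the quadratic forms
    q <= [., .]_L on V such that |k(f, f)| <= q(f) and q(psi_a f) <= c_a q(f),
    Zorn's lemma gives a minimal one, because these constraints pass to the
    infimum of a chain ([minimal_form]). Let q1 be the conjugate form of q,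
    q1(f) = sup_g (2 Re k(f, g) - q(g)). It is at most q, and (q + q1) / 2
    satisfies the same constraints: the bound on the diagonal of k is read off
    from the supremum at g = f and g = - f, and the bound for psi_a follows from
    that of q for the k-adjoint psi_a'. Minimality therefore forces q1 = q. On
    the Hilbert space K obtained from (V, q) this says that the Gram operator J
    of k is isometric; it is selfadjoint as k is hermitian, so J^2 = 1
    ([symmetry_exists]). The operators psi_a extend to K as pi(a), and B h is
    the class of the function with the single value h at 1
    ([dilation_of_majorant]).

    The Hilbert space K is realized as the space of the bounded antilinear
    functionals on (V, q) ([dual_hilbert]). Its squared norm is the Legendre
    transform F |-> sup_x (2 Re F(x) - q(x)), for which the parallelogram law,
    the density of V and the identity <F, x> = F(x) are computations with
    suprema; the inner product is recovered from it by the Jordan-von Neumann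
    theorem ([polarPl]). *)

(** * Complex scalars *)

Section ComplexScalars.
Context {R : realType}.
Implicit Types (c : R[i]) (t : R).

(** The squared modulus of a complex number, as an element of [R]: quadratic forms
    are real valued, while the norm of [R[i]] takes its values in [R[i]]. *)
Definition nsq c : R := complex.Re c ^+ 2 + complex.Im c ^+ 2.

Lemma nsq_ge0 c : 0 <= nsq c.
Proof. by rewrite addr_ge0 ?sqr_ge0. Qed.

Lemma nsqR t : nsq t%:C%C = t ^+ 2.
Proof. by rewrite /nsq /= expr0n addr0. Qed.

Lemma nsqi : nsq 'i%C = 1 :> R.
Proof. by rewrite /nsq /= expr0n expr1n add0r. Qed.

Lemma nsqN1 : nsq (- 1) = 1 :> R.
Proof. by rewrite /nsq /= oppr0 sqrrN expr0n expr1n addr0. Qed.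

Lemma nsqM c d : nsq (c * d) = nsq c * nsq d.
Proof. by case: c d => [a b] [e f]; rewrite /nsq /=; ring. Qed.

Lemma nsq_eq0 c : (nsq c == 0) = (c == 0).
Proof. by rewrite paddr_eq0 ?sqr_ge0// !sqrf_eq0 eq_complex. Qed.

Lemma complexP (c d : R[i]) :
  complex.Re c = complex.Re d -> complex.Im c = complex.Im d -> c = d.
Proof. by case: c d => [a b] [e f] /= -> ->. Qed.

Lemma complex_Re_conj c : complex.Re c^* = complex.Re c.
Proof. by case: c. Qed.
Lemma complex_Im_conj c : complex.Im c^* = - complex.Im c.
Proof. by case: c. Qed.

(** A quadratic polynomial in t that stays nonnegative has a nonpositive
    discriminant; the Cauchy-Schwarz inequalities below are instances. *)
Lemma discriminant_le (M a b : R) : 0 <= b ->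
  (forall t, 2 * t * a <= M + t ^+ 2 * b) -> a ^+ 2 <= M * b.
Proof.
move=> b0 h; have := b0; rewrite le0r => /orP[/eqP b00|bp].
  rewrite b00 mulr0; have [->|a0] := eqVneq a 0; first by rewrite expr0n.
  (* for b = 0 the left-hand side is unbounded in t unless a = 0; this t makes
     it equal to M + 1 *)
  have := h ((M + 1) / (2 * a)); rewrite b00 mulr0 addr0.
  have -> : 2 * ((M + 1) / (2 * a)) * a = M + 1 by field.
  by move=> ?; lra.
have := h (a / b).
have -> : 2 * (a / b) * a = 2 * (a ^+ 2 / b) by ring.
have -> : (a / b) ^+ 2 * b = a ^+ 2 / b by field; rewrite gt_eqF.
by move=> ?; rewrite -ler_pdivrMr//; lra.
Qed.
End ComplexScalars.

(** * Quadratic forms and the Jordan-von Neumann theorem *)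

Section QuadraticForms.
Context {R : realType} {V : lmodType R[i]}.
Implicit Types (x y z : V) (c : R[i]) (t : R).

(** The three conditions are inequalities so that they pass to the infimum of a
    chain. The reverse inequalities follow, by scaling with the inverse scalar
    in [qfZ] and by applying the third condition to x + y and x - y in
    [qf_parallelogram]. *)
Definition quadratic (q : V -> R) :=
  [/\ forall x, 0 <= q x,
      forall c x, q (c *: x) <= nsq c * q x
    & forall x y, q (x + y) + q (x - y) <= 2 * (q x + q y)].

Record qform := QForm { qf :> V -> R; qfP : quadratic qf }.

Variable q : qform.

Lemma qf_ge0 x : 0 <= q x. Proof. by case: (qfP q). Qed.

Lemma qfZ c x : q (c *: x) = nsq c * q x.
Proof.
have [_ qZ _] := qfP q.
have [->|c0] := eqVneq c 0.
  apply/eqP; rewrite eq_le qZ /nsq /= expr0n addr0 mul0r; exact: qf_ge0.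
apply/eqP; rewrite eq_le qZ /=.
have := qZ c^-1 (c *: x); rewrite scalerA mulVf// scale1r.
have cp : 0 < nsq c by rewrite lt_def nsq_ge0 nsq_eq0 c0.
move=> /(ler_wpM2l (ltW cp)) /le_trans; apply.
by rewrite mulrA -nsqM divff// nsqR expr1n mul1r.
Qed.

Lemma qf0 : q 0 = 0.
Proof. by rewrite -(scale0r 0) qfZ nsqR expr0n mul0r. Qed.

Lemma qfN x : q (- x) = q x.
Proof. by rewrite -scaleN1r qfZ nsqN1 mul1r. Qed.

Lemma qfB x y : q (x - y) = q (y - x).
Proof. by rewrite -qfN opprB. Qed.

Lemma qfi x : q ('i%C *: x) = q x.
Proof. by rewrite qfZ nsqi mul1r. Qed.

Lemma qfZR t x : q (t%:C%C *: x) = t ^+ 2 * q x.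
Proof. by rewrite qfZ nsqR. Qed.

Lemma scaleR_nat n x : (n%:R : R)%:C%C *: x = x *+ n.
Proof. by rewrite rmorph_nat scaler_nat. Qed.

Lemma qfMn n x : q (x *+ n) = n%:R ^+ 2 * q x.
Proof. by rewrite -scaleR_nat qfZR. Qed.

Lemma qf_parallelogram x y : q (x + y) + q (x - y) = 2 * (q x + q y).
Proof.
have [_ _ par] := qfP q; apply/eqP; rewrite eq_le par /=.
have := par (x + y) (x - y).
have -> : x + y + (x - y) = x *+ 2 by rewrite addrACA subrr addr0.
have -> : x + y - (x - y) = y *+ 2.
  by rewrite opprB (addrC x) addrACA subrr addr0.
rewrite !qfMn; move=> ?; lra.
Qed.

(** The real part of the inner product whose squared norm is [q]. *)
Definition rpolar x y : R := (q (x + y) - q (x - y)) / 4.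

Lemma qfD x y : q (x + y) = q x + q y + 2 * rpolar x y.
Proof. by have := qf_parallelogram x y; rewrite /rpolar => ?; lra. Qed.

Lemma rpolarC x y : rpolar x y = rpolar y x.
Proof. by rewrite /rpolar (addrC x) (qfB x). Qed.

Lemma rpolarNl x y : rpolar (- x) y = - rpolar x y.
Proof.
rewrite /rpolar -opprD qfN (_ : - x + y = - (x - y)) ?qfN; last first.
  by rewrite opprB addrC.
by ring.
Qed.

Lemma rpolari x y : rpolar ('i%C *: x) ('i%C *: y) = rpolar x y.
Proof. by rewrite /rpolar -scalerDr -scalerBr !qfi. Qed.

(** The parallelogram law for (x + z, y + z) and for (x - z, y - z) compares
    the two sides up to doubling z; the case y = 0 removes the doubling. *)
Lemma rpolarDl x y z : rpolar (x + y) z = rpolar x z + rpolar y z.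
Proof.
have half u v : rpolar u z + rpolar v z = rpolar (u + v) (z *+ 2) / 2.
  have h1 := qf_parallelogram (u + z) (v + z).
  have h2 := qf_parallelogram (u - z) (v - z).
  move: h1 h2; rewrite !opprD !addrA.
  have -> : u + z + v + z = u + v + z *+ 2.
    by rewrite mulr2n addrA (addrAC u z v).
  have -> : u + z - v - z = u - v by rewrite addrAC addrK.
  have -> : u - z + v - z = u + v - z *+ 2.
    by rewrite mulr2n opprD addrA (addrAC u _ v).
  have -> : u - z - v - - z = u - v by rewrite opprK (addrAC u) subrK.
  by rewrite /rpolar => *; lra.
have z0 : rpolar 0 z = 0 by rewrite /rpolar add0r sub0r qfN subrr mul0r.
by have := half (x + y) 0; rewrite z0 !addr0 half.
Qed.

Lemma rpolarMn n x y : rpolar (x *+ n) y = rpolar x y *+ n.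
Proof.
elim: n => [|n IH]; last by rewrite !mulrS rpolarDl IH.
by rewrite !mulr0n /rpolar add0r sub0r qfN subrr mul0r.
Qed.

Lemma rpolar_abs x y : `|rpolar x y| <= (q x + q y) / 2.
Proof.
have h := qf_parallelogram x y; have h1 := qf_ge0 (x + y).
have h2 := qf_ge0 (x - y).
by rewrite /rpolar ler_norml; apply/andP; split; lra.
Qed.

(** The defect g(t) of homogeneity is additive in t, vanishes on the natural
    numbers, and is bounded on [0, 1] by the parallelogram law. Being
    1-periodic it is bounded everywhere, and a bounded additive function is
    zero. *)
Lemma rpolarZl t x y : rpolar (t%:C%C *: x) y = t * rpolar x y.
Proof.
pose g s := rpolar (s%:C%C *: x) y - s * rpolar x y.
have gD r s : g (r + s) = g r + g s.
  by rewrite /g rmorphD scalerDl rpolarDl; ring.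
have gMn n s : g (n%:R * s) = n%:R * g s.
  by rewrite /g rmorphM -scalerA scaleR_nat rpolarMn -[_ *+ n]mulr_natl; ring.
have gn n : g n%:R = 0.
  by rewrite /g scaleR_nat rpolarMn mulr_natl subrr.
have gN s : g (- s) = - g s.
  by apply/eqP; rewrite -addr_eq0 -gD addNr; exact/eqP/(gn 0%N).
pose M := (q x + q y) / 2 + `|rpolar x y|.
have gb0 s : 0 <= s <= 1 -> `|g s| <= M.
  move=> /andP[s0 s1]; rewrite (le_trans (ler_normB _ _))// lerD//.
    rewrite (le_trans (rpolar_abs _ _))// qfZR ler_wpM2r ?invr_ge0// lerD2r.
    by rewrite ler_piMl ?qf_ge0// exprn_ile1.
  by rewrite normrM ger0_norm// ler_piMl.
have gb s : `|g s| <= M.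
  wlog s0 : s / 0 <= s.
    move=> h; have [/h//|/ltW s0] := leP 0 s.
    by rewrite -normrN -gN h// oppr_ge0.
  have /andP[h1 h2] := Num.Theory.truncn_itv s0.
  rewrite -[s](subrK (Num.truncn s)%:R) gD gn addr0 gb0// subr_ge0 h1 /=.
  by rewrite lerBlDr -natr1 addrC in h2 *; exact: ltW.
suff : g t = 0 by move/eqP; rewrite subr_eq0 => /eqP.
apply/eqP; rewrite -normr_le0 leNgt; apply/negP => gt0.
have := Num.Theory.truncnS_gt (M / `|g t|).
rewrite ltr_pdivrMr// => h; have := gb ((Num.truncn (M / `|g t|)).+1%:R * t).
by rewrite gMn normrM ger0_norm// leNgt h.
Qed.

(** Linear in the first argument: the imaginary part of <x, y> is the real part
    of <x, iy>. *)
Definition polar x y : R[i] := (rpolar x y +i* rpolar x ('i%C *: y))%C.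

Lemma rpolariC x y : rpolar ('i%C *: x) y = - rpolar x ('i%C *: y).
Proof.
rewrite -rpolari scalerA -expr2 sqr_i scaleN1r.
by rewrite rpolarNl.
Qed.

Lemma polarC x y : polar x y = (polar y x)^*.
Proof.
apply: complexP; rewrite ?complex_Re_conj ?complex_Im_conj /=.
  exact: rpolarC.
by rewrite rpolarC rpolariC.
Qed.

Lemma polarPl c x y z : polar (c *: x + y) z = c * polar x z + polar y z.
Proof.
have -> : c *: x =
    (complex.Re c)%:C%C *: x + (complex.Im c)%:C%C *: ('i%C *: x).
  rewrite scalerA -scalerDl; congr (_ *: _).
  by case: c => a b; apply: complexP => /=; ring.
apply: complexP; rewrite /= !rpolarDl !rpolarZl !rpolariC.
  by case: c => a b /=; ring.
rewrite scalerA -expr2 sqr_i scaleN1r (rpolarC x (- z)) rpolarNl (rpolarC z).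
by case: c => a b /=; ring.
Qed.

Lemma polarPr c x y z : polar z (c *: x + y) = c^* * polar z x + polar z y.
Proof. by rewrite polarC polarPl rmorphD rmorphM (polarC z x) (polarC z y). Qed.

Lemma polarxx x : polar x x = (q x)%:C%C.
Proof.
apply: complexP => /=; first by have := qfD x x; rewrite -mulr2n qfMn => ?; lra.
by have := rpolariC x x; rewrite rpolarC => ?; lra.
Qed.

Lemma triangle_sqrt x y :
  Num.sqrt (q (x + y)) <= Num.sqrt (q x) + Num.sqrt (q y).
Proof.
have h : rpolar x y ^+ 2 <= q x * q y.
  apply: discriminant_le; first exact: qf_ge0.
  move=> t; have := qf_ge0 (x - t%:C%C *: y).
  rewrite qfD qfN qfZR rpolarC rpolarNl rpolarZl rpolarC => ?; lra.
rewrite -(@ler_pXn2r _ 2) ?nnegrE ?addr_ge0 ?sqrtr_ge0//.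
rewrite sqr_sqrtr ?qf_ge0// sqrrD !sqr_sqrtr ?qf_ge0// qfD [leRHS]addrAC lerD2l.
rewrite -[leRHS]mulr_natl ler_pM2l// -sqrtrM ?qf_ge0//.
by rewrite (le_trans (ler_norm _))// -sqrtr_sqr ler_sqrt// mulr_ge0 ?qf_ge0.
Qed.
End QuadraticForms.
Arguments qform {R} V.

(** * The Hilbert space of bounded antilinear functionals *)

Section Dual.
Context {R : realType} {V : lmodType R[i]} (q : qform V).
Implicit Types (x y z : V) (c : R[i]) (t : R).

Definition antilinear (F : V -> R[i]) :=
  forall c x y, F (c *: x + y) = c^* * F x + F y.

Lemma antilinear0 F : antilinear F -> F 0 = 0.
Proof.
by move=> /(_ (-1) 0 0); rewrite scaler0 add0r rmorphN1 mulN1r addNr.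
Qed.

Lemma antilinearZ F c x : antilinear F -> F (c *: x) = c^* * F x.
Proof. by move=> aF; rewrite -[c *: x]addr0 aF antilinear0// addr0. Qed.

Lemma antilinearD F x y : antilinear F -> F (x + y) = F x + F y.
Proof. by move=> aF; rewrite -[x in LHS]scale1r aF rmorph1 mul1r. Qed.

Lemma antilinearB F x y : antilinear F -> F (x - y) = F x - F y.
Proof. by move=> aF; rewrite addrC -scaleN1r aF rmorphN1 mulN1r addrC. Qed.

(** Boundedness in the form of the Legendre transform: it is equivalent to a
    bound of |F x|^2 by a multiple of [q x], but needs no square root. *)
Definition antibounded : {pred V -> R[i]^o} := fun F =>
  `[< antilinear F /\
      exists M : R, forall x, 2 * complex.Re (F x) - q x <= M >].

Lemma antibounded_submod : submod_closed antibounded.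
Proof.
split=> [|c F G /asboolP[aF [M FM]] /asboolP[aG [N GN]]]; apply/asboolP.
  split=> [c x y|]; first by rewrite [RHS]addr0 [RHS]mulr0.
  exists 0 => x; rewrite (_ : complex.Re _ = 0)//.
  by rewrite mulr0 sub0r oppr_le0 qf_ge0.
split=> [d x y|].
  by rewrite !fctE aF aG /GRing.scale /=; ring.
exists (2 * nsq c * M + 2 * N) => x.
(* each summand takes half of q x; as F is homogeneous of degree 1 and q of
   degree 2, rescaling x then gives back the bound of F *)
have h1 : 2 * complex.Re (c * F x) - q x / 2 <= 2 * nsq c * M.
  have [->|c0] := eqVneq c 0.
    rewrite mul0r mulr0 sub0r /nsq /= expr0n addr0 mulr0 mul0r oppr_le0.
    by rewrite divr_ge0 ?qf_ge0.
  have xE : x = (2 * c) *: ((2 * c)^-1 *: x).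
    by rewrite scalerA divff ?scale1r// mulf_neq0// pnatr_eq0.
  set y := _ *: x in xE; rewrite xE antilinearZ// qfZ nsqM.
  have -> : complex.Re (c * ((2 * c)^* * F y)) = 2 * nsq c * complex.Re (F y).
    by case: (c) (F y) => [a b] [e f]; rewrite /nsq /=; ring.
  have -> : nsq (2 : R[i]) = 4.
    by rewrite -(rmorph_nat (real_complex R) 2) nsqR; ring.
  have := ler_wpM2l (_ : 0 <= 2 * nsq c) (FM y).
  rewrite mulr_ge0 ?nsq_ge0// => /(_ isT); move=> ?; lra.
have h2 : 2 * complex.Re (G x) - q x / 2 <= 2 * N.
  have xE : x = (2%:R:R)%:C%C *: ((2%:R^-1:R)%:C%C *: x).
    by rewrite scalerA -rmorphM divff ?scale1r// pnatr_eq0.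
  set y := _ *: x in xE; rewrite xE antilinearZ// qfZR.
  have := GN y; set w := G y.
  have -> : complex.Re ((2%:R:R)%:C^*%C * w) = 2 * complex.Re w.
    by case: (w) => a b /=; ring.
  move=> ?; lra.
by rewrite !fctE ReD -[c *: F x]/(c * F x) ; lra.
Qed.

HB.instance Definition _ := GRing.isSubmodClosed.Build R[i] (V -> R[i]^o)
  antibounded antibounded_submod.

Record dual := Dual {
  dual_fun :> V -> R[i]^o;
  dualP : dual_fun \in antibounded }.

HB.instance Definition _ := [isSub for dual_fun].
HB.instance Definition _ := [Choice of dual by <:].
HB.instance Definition _ := [SubChoice_isSubLmodule of dual by <:].

Implicit Types F G : dual.

Lemma dual_anti F : antilinear F. Proof. by have /asboolP[] := dualP F. Qed.

Lemma dual_oppr F x : F (- x) = - F x.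
Proof. 
have aF := dual_anti F.
by rewrite -[- x]sub0r antilinearB// antilinear0// sub0r.
Qed.

Lemma dual_ext F G : F =1 G -> F = G.
Proof. by move=> FG; apply/val_inj/funext. Qed.

Lemma dualDE F G x : (F + G) x = F x + G x. Proof. by []. Qed.
Lemma dualNE F x : (- F) x = - F x. Proof. by []. Qed.
Lemma dualZE c F x : (c *: F) x = c * F x. Proof. by []. Qed.

(** The squared dual norm, as a Legendre transform. *)
Definition dnorm2 F : R := sup [set 2 * complex.Re (F x) - q x | x in setT].

Lemma dnorm2_has_sup F : has_sup [set 2 * complex.Re (F x) - q x | x in setT].
Proof.
split; first by exists (2 * complex.Re (F 0) - q 0), 0.
by have /asboolP[_ [M FM]] := dualP F; exists M => _ [x _ <-].
Qed.

Lemma dnorm2_ub F x : 2 * complex.Re (F x) - q x <= dnorm2 F.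
Proof. by apply: sup_upper_bound; [exact: dnorm2_has_sup|exists x]. Qed.

Lemma dnorm2_le F M :
  (forall x, 2 * complex.Re (F x) - q x <= M) -> dnorm2 F <= M.
Proof.
move=> FM; apply: ge_sup => [|_ [x _ <-]//].
by case: (dnorm2_has_sup F).
Qed.

Lemma dnorm2_approx F e : 0 < e ->
  exists x, dnorm2 F - e < 2 * complex.Re (F x) - q x.
Proof.
move=> e0; have [_ [x _ <-] h] := sup_adherent e0 (dnorm2_has_sup F).
by exists x.
Qed.

(** The substitution u = (x + y) / 2, v = (x - y) / 2 turns the sum of the
    suprema for F + G and F - G into twice the sum of those for F and G, by the
    parallelogram law of [q]. *)
Lemma dnorm2_quadratic : quadratic dnorm2.
Proof.
split=> [F|c F|F G].
- have := dnorm2_ub F 0; rewrite antilinear0 ?qf0 ?mulr0 ?subr0//.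
  exact: dual_anti.
- apply: dnorm2_le => x; rewrite dualZE.
  have [->|c0] := eqVneq c 0.
    by rewrite mul0r mulr0 sub0r /nsq /= expr0n addr0 mul0r oppr_le0 qf_ge0.
  (* the supremum is reparametrized by x = c y *)
  have xE : x = c *: (c^-1 *: x) by rewrite scalerA divff// scale1r.
  set y := _ *: x in xE; rewrite xE antilinearZ; last exact: dual_anti.
  rewrite qfZ.
  have -> : complex.Re (c * (c^* * F y)) = nsq c * complex.Re (F y).
    by case: (c) (F y) => [a b] [e f]; rewrite /nsq /=; ring.
  have := ler_wpM2l (nsq_ge0 c) (dnorm2_ub F y) => ?; lra.
- rewrite -lerBrDr; apply: dnorm2_le => x; rewrite lerBrDr addrC -lerBrDr.
  apply: dnorm2_le => y; rewrite lerBrDr !dualDE dualNE.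
  have := dnorm2_ub F ((2%:R^-1:R)%:C%C *: (x + y)).
  have := dnorm2_ub G ((2%:R^-1:R)%:C%C *: (x - y)).
  have := qf_parallelogram q x y.
  rewrite !antilinearZ ?antilinearB ?antilinearD ?qfZR; do ?exact: dual_anti.
  case: (F x) (F y) (G x) (G y) => [a a'] [b b'] [e e'] [f f'] /=.
  move=> *; lra.
Qed.

Definition dqf : qform dual := QForm dnorm2_quadratic.

Lemma dual_bound F x : complex.Re (F x) ^+ 2 <= dnorm2 F * q x.
Proof.
apply: discriminant_le; first exact: qf_ge0.
move=> t; have := dnorm2_ub F (t%:C%C *: x).
rewrite antilinearZ ?qfZR; last exact: dual_anti.
by case: (F x) => a b /=; move=> ?; lra.
Qed.

Lemma dual_Im F x : complex.Im (F x) = complex.Re (F ('i%C *: x)).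
Proof.
rewrite antilinearZ; last exact: dual_anti.
by case: (F x) => a b /=; ring.
Qed.

Lemma dnorm2_eq0 F : dnorm2 F = 0 -> F = 0.
Proof.
move=> F0; have h x : complex.Re (F x) = 0.
  apply/eqP; rewrite -sqrf_eq0 eq_le sqr_ge0 andbT.
  by rewrite (le_trans (dual_bound F x))// F0 mul0r.
by apply: dual_ext => x; apply: complexP; rewrite ?dual_Im h.
Qed.

Definition dnorm F : R[i] := (Num.sqrt (dnorm2 F))%:C%C.

Lemma dnormD F G : dnorm (F + G) <= dnorm F + dnorm G.
Proof. by rewrite -rmorphD lecR; exact: (triangle_sqrt dqf). Qed.

Lemma sqrt_nsq c : (Num.sqrt (nsq c))%:C%C = `|c|.
Proof. by case: c => a b; rewrite normc_def. Qed.

Lemma dnormZ c F : dnorm (c *: F) = `|c| * dnorm F.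
Proof.
rewrite -sqrt_nsq -rmorphM -sqrtrM ?nsq_ge0//; congr (Num.sqrt _)%:C%C.
exact: (qfZ dqf).
Qed.

Lemma dnorm_eq0 F : dnorm F = 0 -> F = 0.
Proof.
move=> /complexI /eqP; rewrite sqrtr_eq0 => F0; apply: dnorm2_eq0.
by apply/eqP; rewrite eq_le F0; exact: (qf_ge0 dqf).
Qed.

HB.instance Definition _ :=
  Lmodule_isNormed.Build R[i] dual dnormD dnormZ dnorm_eq0.

Lemma dual_normE F : `|F| = (Num.sqrt (dnorm2 F))%:C%C. Proof. by []. Qed.

Lemma dnorm_le F r : 0 <= r -> (`|F| <= r%:C%C) = (dnorm2 F <= r ^+ 2).
Proof.
move=> r0; rewrite dual_normE lecR -(@ler_pXn2r _ 2) ?nnegrE ?sqrtr_ge0//.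
by rewrite sqr_sqrtr//; exact: (qf_ge0 dqf).
Qed.

(** The real parts of the values at x converge along a Cauchy filter, and
    determine the limit functional. Inequalities 2 Re F(x) - q(x) <= M pass to
    the limit, which gives both its boundedness and the convergence in norm. *)
Lemma dual_complete (E : set_system dual) : ProperFilter E -> cauchy E -> cvg E.
Proof.
move=> EP cE.
have small r : 0 < r -> exists F, E [set G | dnorm2 (F - G) <= r ^+ 2].
  move=> r0; have r0' : 0 < r%:C%C :> R[i] by rewrite ltr0c.
  have [F EF] := (cauchyP E).1 cE _ r0'; exists F.
  apply: filterS EF => G; rewrite -ball_normE /= => /ltW.
  by rewrite dnorm_le// ltW.
pose ev x F := complex.Re (F x).
have evB x F G r : 0 <= r -> dnorm2 (F - G) <= r ^+ 2 ->
    `|ev x F - ev x G| <= r * Num.sqrt (q x).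
  move=> r0 FG; have := dual_bound (F - G) x.
  rewrite dualDE dualNE ReD ReN => h.
  rewrite -(@ler_pXn2r _ 2) ?nnegrE ?mulr_ge0 ?sqrtr_ge0//.
  rewrite real_normK ?num_real//.
  rewrite exprMn sqr_sqrtr ?qf_ge0// (le_trans h)//.
  by rewrite ler_wpM2r ?qf_ge0.
have ev_cvg x : cvg (ev x @ E).
  apply: cauchy_cvg; apply: cauchy_exP => e e0.
  have p : 0 < Num.sqrt (q x) + 1 by rewrite ltr_wpDl ?sqrtr_ge0.
  have [F EF] := small (e / (Num.sqrt (q x) + 1)) (divr_gt0 e0 p).
  exists (ev x F); suff : E (ev x @^-1` ball (ev x F) e) by [].
  apply: filterS EF => G FG.
  rewrite -ball_normE /=; apply: le_lt_trans (evB _ _ _ _ _ FG) _.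
    by rewrite divr_ge0 ?ltW.
  by rewrite -mulrA gtr_pMr// mulrC ltr_pdivrMr// mul1r ltrDl.
pose u x := lim (ev x @ E).
have uP c x y : u (c *: x + y)
    = complex.Re c * u x + complex.Im c * u ('i%C *: x) + u y.
  apply/cvg_lim => //.
  have -> : ev (c *: x + y) = fun F =>
      complex.Re c * ev x F + complex.Im c * ev ('i%C *: x) F + ev y F.
    apply/funext => F; rewrite /ev dual_anti -dual_Im ReD.
    by case: c (F x) => [a b] [e f] /=; ring.
  by apply: cvgD (ev_cvg y); apply: cvgD;
    apply: cvgM (cvg_cst _) _; exact: ev_cvg.
pose f x : R[i] := (u x +i* u ('i%C *: x))%C.
have fA : antilinear f.
  move=> c x y; apply: complexP => /=.
    by rewrite uP; case: (c) => a b /=; ring.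
  by rewrite scalerDr scalerA uP; case: (c) => a b /=; ring.
have fB F r : 0 <= r -> E [set G | dnorm2 (F - G) <= r ^+ 2] ->
    forall x, 2 * complex.Re (f x - F x) - q x <= r ^+ 2.
  move=> r0 EF x; rewrite ReD ReN /=.
  have : u x <= (r ^+ 2 + q x) / 2 + complex.Re (F x).
    apply: limr_le; first exact: ev_cvg.
    apply: filterS EF => G; rewrite /= (qfB dqf F G : dnorm2 _ = dnorm2 _) => FG.
    have := dnorm2_ub (G - F) x; rewrite dualDE dualNE ReD ReN /ev => ?; lra.
  by move=> ?; lra.
have fbd : (f : V -> R[i]^o) \in antibounded.
  have [F EF] := small 1 ltr01.
  have -> : (f : V -> R[i]^o) = (F : V -> R[i]^o) + (f - (F : V -> R[i]^o)).
    by rewrite addrC subrK.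
  apply: rpredD; first exact: dualP.
  apply/asboolP; split; last by exists (1 ^+ 2); exact: fB.
  move=> c x y; rewrite !fctE fA dual_anti; ring.
apply/cvg_ex; exists (Dual fbd); apply/cvg_ballP => e e0.
have [r r0 ->] : exists2 r : R, 0 < r & e = r%:C%C.
  have er : e \is Num.real by rewrite gtr0_real.
  by exists (complex.Re e); [rewrite -ltr0c RRe_real|rewrite RRe_real].
have r3 : 0 < r / 3 by rewrite divr_gt0.
have [F EF] := small _ r3.
apply: filterS (EF) => G FG; rewrite -ball_normE /=.
apply: le_lt_trans (ler_distD F _ _) _.
apply: (@le_lt_trans _ _ ((r / 3)%:C%C + (r / 3)%:C%C)).
  apply: lerD; rewrite dnorm_le ?(ltW r3)//.
  by apply: dnorm2_le => x; exact: (fB _ _ (ltW r3) EF).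
by rewrite -rmorphD ltcR; lra.
Qed.

HB.instance Definition _ := Uniform_isComplete.Build dual dual_complete.

Definition dual_dot F G : R[i] := polar dqf F G.

Lemma dual_dot_bilinear : bilinear_for *%R (Num.conj \; *%R) dual_dot.
Proof.
split=> [G c F F'|F c G G']; first exact: polarPl.
exact: polarPr.
Qed.
HB.instance Definition _ := bilinear_isBilinear.Build R[i] dual dual R[i]
  *%R (Num.conj \; *%R) dual_dot dual_dot_bilinear.
Lemma dual_dot_herm F G : dual_dot F G = (-1) ^+ false * (dual_dot G F)^*.
Proof. by rewrite expr0 mul1r; exact: polarC. Qed.
HB.instance Definition _ := isHermitianSesquilinear.Build R[i] dual
  false Num.conj dual_dot dual_dot_herm.
Lemma dual_dot_gt0 F : F != 0 -> 0 < dual_dot F F.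
Proof.
move=> F0; rewrite /dual_dot polarxx ltr0c lt_def qf_ge0 andbT.
by apply: contra_neq F0; exact: dnorm2_eq0.
Qed.
HB.instance Definition _ := isDotProduct.Build R[i] dual dual_dot dual_dot_gt0.
Lemma dual_dotxx F : dual_dot F F = `|F| ^+ 2.
Proof.
rewrite dual_normE /dual_dot polarxx -rmorphXn sqr_sqrtr//.
exact: (qf_ge0 dqf).
Qed.
HB.instance Definition _ := isHilbert.Build R dual dual_dotxx.

(** Completing the square: this makes the Legendre transform of <x, _> equal to
    [q x]. *)
Lemma rpolar_twist x y : 2 * rpolar q x y - q y = q x - q (x - y).
Proof.
by rewrite (qfD q x) qfN (rpolarC q x (- y)) rpolarNl (rpolarC q y); ring.
Qed.

Lemma emb_subproof x : (polar q x : V -> R[i]^o) \in antibounded.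
Proof.
apply/asboolP; split=> [c y z|]; first exact: polarPr.
exists (q x) => y; rewrite rpolar_twist.
by rewrite gerBl qf_ge0.
Qed.
Definition emb x : dual := Dual (emb_subproof x).

Lemma emb_linear : linear emb.
Proof. by move=> c x y; apply: dual_ext => z; exact: polarPl. Qed.
HB.instance Definition _ := GRing.isLinear.Build R[i] V dual _ emb emb_linear.

(** Adding <x, _> to F translates the variable of the supremum by x. *)
Lemma dnorm2D_emb F x :
  dnorm2 (F + emb x) = dnorm2 F + q x + 2 * complex.Re (F x).
Proof.
have le G z : dnorm2 (G + emb z) <= dnorm2 G + q z + 2 * complex.Re (G z).
  apply: dnorm2_le => y; have := dnorm2_ub G (y - z).
  rewrite antilinearB; last exact: dual_anti.
  rewrite dualDE !ReD ReN (_ : complex.Re (emb z y) = rpolar q z y)//.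
  by have := rpolar_twist z y; rewrite (qfB q z y) => *; lra.
apply/eqP; rewrite eq_le le /=.
have := le (F + emb x) (- x).
rewrite dual_oppr qfN linearN [_ + _ - _]addrK.
have -> : complex.Re (- (F + emb x) x) = - (complex.Re (F x) + q x).
  rewrite ReN dualDE ReD; congr (- (_ + _)).
  by rewrite [RHS](_ : _ = complex.Re (q x)%:C%C)// -polarxx.
by move=> ?; lra.
Qed.

Lemma dnorm2_emb x : dnorm2 (emb x) = q x.
Proof.
have := dnorm2D_emb 0 x.
rewrite add0r (qf0 dqf : dnorm2 0 = 0) (_ : complex.Re _ = 0)//.
by rewrite mulr0 addr0 add0r.
Qed.

Lemma Re_hdot_emb F x : complex.Re '[<F, emb x>] = complex.Re (F x).
Proof.
have -> : complex.Re '[<F, emb x>]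
    = (dnorm2 (F + emb x) - dnorm2 (F - emb x)) / 4 by [].
have := dnorm2D_emb F x; have := dnorm2D_emb F (- x).
rewrite dual_oppr ReN qfN linearN /=.
by move=> *; lra.
Qed.

(** The reproducing property; polarization of [dnorm2D_emb]. *)
Lemma hdot_emb F x : '[<F, emb x>] = F x.
Proof.
apply: complexP; first exact: Re_hdot_emb.
rewrite dual_Im -Re_hdot_emb.
have -> : emb ('i%C *: x) = 'i%C *: emb x + 0 by rewrite linearZ addr0.
rewrite hdotPr linear0r.
by case: '[<F, emb x>] => a b /=; ring.
Qed.

(** If x almost attains the supremum that defines the norm of F, then F is
    close to <x, _>, by [dnorm2D_emb] applied to - x. *)
Lemma emb_dense F e : 0 < e -> exists x, dnorm2 (F - emb x) < e.
Proof.
move=> e0; have [x Fx] := dnorm2_approx F e0; exists x.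
rewrite -linearN /= dnorm2D_emb qfN dual_oppr ReN; lra.
Qed.

Lemma dual_dot_eq F G : (forall x, '[<F, emb x>] = '[<G, emb x>]) -> F = G.
Proof. by move=> FG; apply: dual_ext => x; rewrite -!hdot_emb. Qed.
End Dual.

(** * Hermitian forms dominated by a quadratic form, and minimal majorants *)

Section HermitianForms.
Context {R : realType} {V : lmodType R[i]}.
Implicit Types (x y z : V) (q : V -> R).

Definition hermitian_form (k : V -> V -> R[i]) :=
  (forall z c x y, k (c *: x + y) z = c * k x z + k y z) /\
  (forall x y, k x y = (k y x)^*).

Variables (k : V -> V -> R[i]) (kH : hermitian_form k).

Definition dominated q := forall x, `|complex.Re (k x x)| <= q x.

Lemma form_anti x : antilinear (k x).
Proof.
by move=> c y z; rewrite kH.2 kH.1 rmorphD rmorphM (kH.2 x y) (kH.2 x z).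
Qed.

Lemma herm_formDl x y z : k (x + y) z = k x z + k y z.
Proof. by rewrite -[x in LHS]scale1r kH.1 mul1r. Qed.

Lemma herm_formBl x y z : k (x - y) z = k x z - k y z.
Proof. by rewrite addrC -scaleN1r kH.1 mulN1r addrC. Qed.

Lemma form_polar x y :
  4 * complex.Re (k x y) =
  complex.Re (k (x + y) (x + y)) - complex.Re (k (x - y) (x - y)).
Proof.
rewrite herm_formBl herm_formDl.
rewrite !(antilinearB _ _ (form_anti _)) !(antilinearD _ _ (form_anti _)).
rewrite (kH.2 y x) !(ReD, ReN, complex_Re_conj); ring.
Qed.

Section Dominated.
Variables (q : qform V) (kq : dominated q).

(** Polarization of k against the parallelogram law of [q]; this is the
    Cauchy-Schwarz inequality for k in a form without square roots. *)
Lemma Re_form_le x y : 2 * complex.Re (k x y) - q y <= q x.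
Proof.
have := form_polar x y; have := qf_parallelogram q x y.
have := kq (x + y); have := kq (x - y).
by rewrite !ler_norml => /andP[? ?] /andP[? ?] *; lra.
Qed.

Lemma riesz_subproof x : (k x : V -> R[i]^o) \in antibounded q.
Proof.
apply/asboolP; split; first exact: form_anti.
by exists (q x); exact: Re_form_le.
Qed.
(** The Gram operator of k, from V to the dual of (V, q). *)
Definition gram x : dual q := Dual (riesz_subproof x).

Lemma gram_linear : linear gram.
Proof. by move=> c x y; apply: dual_ext => z; exact: kH.1. Qed.
HB.instance Definition _ :=
  GRing.isLinear.Build R[i] V (dual q) _ gram gram_linear.

Definition conjugate_form x : R := dnorm2 (gram x).

Lemma conjugate_form_le x : conjugate_form x <= q x.
Proof. by apply: dnorm2_le; exact: Re_form_le. Qed.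

(** One Newton step (G + A G^-1 A) / 2 for the modulus of A, where G and A are
    the operators of [q] and k; its fixed points are the q with A G^-1 A = G. *)
Definition newton_form x : R := (q x + conjugate_form x) / 2.

Lemma newton_quadratic : quadratic newton_form.
Proof.
split=> [x|c x|x y]; rewrite /newton_form /conjugate_form.
- by rewrite divr_ge0// addr_ge0 ?qf_ge0//; exact: (qf_ge0 (dqf q)).
- rewrite linearZ /= qfZ (qfZ (dqf q) c (gram x) : dnorm2 _ = _) /=; lra.
- rewrite linearB linearD /=; have := qf_parallelogram q x y.
  by have := qf_parallelogram (dqf q) (gram x) (gram y); rewrite /= => *; lra.
Qed.

(** The values at x and - x in the supremum that defines the conjugate form
    are 2 k(x, x) - q(x) and - 2 k(x, x) - q(x). *)
Lemma newton_dominated : dominated newton_form.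
Proof.
move=> x; rewrite /newton_form /conjugate_form ler_norml.
have h1 := dnorm2_ub (gram x) x.
have := dnorm2_ub (gram x) (- x).
rewrite qfN dual_oppr ReN.
by move: h1; rewrite /= => *; apply/andP; split; lra.
Qed.

(** Since k(f x, y) = k(x, g y), the supremum for f x runs over the vectors g y,
    that is, over a part of the supremum for x after rescaling by c. *)
Lemma conjugate_form_bounded (f g : V -> V) (c : R) : 0 < c ->
  (forall x y, k (f x) y = k x (g y)) -> (forall x, q (g x) <= c * q x) ->
  forall x, conjugate_form (f x) <= c * conjugate_form x.
Proof.
move=> c0 fg gc x; apply: dnorm2_le => y; rewrite /= fg.
have yE : g y = c%:C%C *: ((c^-1)%:C%C *: g y).
  by rewrite scalerA -rmorphM divff ?scale1r// gt_eqF.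
have := gc y; rewrite yE; set w := _ *: g y.
rewrite (antilinearZ _ _ (form_anti _)) qfZR expr2 -mulrA ler_pM2l// => h.
have := ler_wpM2l (ltW c0) (dnorm2_ub (gram x) w).
have -> : complex.Re ((c%:C)^*%C * k x w) = c * complex.Re (k x w).
  by case: (k x w) => a b /=; ring.
rewrite /conjugate_form /= => ?; lra.
Qed.
End Dominated.

Section Minimal.
Variables (I : Type) (op : I -> V -> V) (inv : I -> I) (c : I -> R).
Hypothesis op_adj : forall a x y, k (op a x) y = k x (op (inv a) y).
Hypothesis c_gt0 : forall a, 0 < c a.
Hypothesis c_inv : forall a, c (inv a) = c a.

(** The constants are fixed in advance: a chain of forms that are merely bounded
    for each operator may have an infimum that is not. *)
Definition admissible q :=
  dominated q /\ forall a x, q (op a x) <= c a * q x.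

Lemma newton_admissible (q : qform V) (kq : dominated q) :
  admissible q -> admissible (newton_form kq).
Proof.
move=> [_ qop]; split; first exact: newton_dominated.
move=> a x; have h1 := qop a x.
have h2 : conjugate_form kq (op a x) <= c a * conjugate_form kq x.
  apply: (@conjugate_form_bounded _ _ _ (op (inv a))) => // y.
  by rewrite -(c_inv a).
by rewrite /newton_form; lra.
Qed.

(** The Newton step of a minimal admissible form is admissible and below it,
    hence equal to it. *)
Lemma minimal_form (q0 : qform V) : admissible q0 ->
  exists q : qform V, [/\ admissible q, forall x, q x <= q0 x
    & forall kq : dominated q, conjugate_form kq =1 q].
Proof.
move=> q0P.
pose T := {q : qform V | admissible q /\ forall x, q x <= q0 x}.
pose le (s t : T) := `[< forall x, sval t x <= sval s x >].
have [||||[q [qA qq0]] qmin] := @Zorn T le.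
- by move=> t; apply/asboolP => x.
- move=> r s t /asboolP rs /asboolP st; apply/asboolP => x.
  exact: le_trans (st x) (rs x).
- move=> [[s sq] sP] [[t tq] tP] /asboolP st /asboolP ts.
  have E : s = t by apply/funext => x; apply/eqP; rewrite eq_le ts st.
  subst t; apply: eq_exist => /=; congr QForm; exact: Prop_irrelevance.
- move=> A Atot; have [[s0 As0]|A0] := pselect (exists s, A s); last first.
    exists (exist _ q0 (conj q0P (fun x => lexx _))) => s As.
    by exfalso; apply: A0; exists s.
  (* a lower bound of a nonempty chain is its pointwise infimum *)
  pose S x := [set sval s x | s in A].
  have Sinf x : has_inf (S x).
    by split; [exists (sval s0 x), s0|exists 0 => _ [s _ <-]; exact: qf_ge0].
  pose m x := inf (S x).
  have m_le s x : A s -> m x <= sval s x.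
    by move=> As; apply: ge_inf; [case: (Sinf x)|exists s].
  have m_ge x M : (forall s, A s -> M <= sval s x) -> M <= m x.
    move=> h; apply: lb_le_inf; first by case: (Sinf x).
    by move=> _ [s As <-]; exact: h.
  have mq : quadratic m.
    split=> [x|d x|x y].
    - by apply: (m_ge) => s _; exact: qf_ge0.
    - have [->|d0] := eqVneq d 0.
        rewrite scale0r /nsq /= expr0n addr0 mul0r.
        by rewrite (le_trans (m_le _ _ As0))// qf0.
      have dp : 0 < nsq d by rewrite lt_def nsq_ge0 nsq_eq0 d0.
      rewrite mulrC -ler_pdivrMr//; apply: (m_ge) => s As.
      by rewrite ler_pdivrMr// mulrC -qfZ m_le.
    - suff : (m (x + y) + m (x - y)) / 2 - m y <= m x by move=> ?; lra.
      apply: (m_ge) => s As.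
      suff : (m (x + y) + m (x - y)) / 2 - sval s x <= m y by move=> ?; lra.
      apply: (m_ge) => t At.
      (* the chain condition lets one form be small at both x and y *)
      have [r Ar [rs rt]] : exists2 r, A r &
          (sval r x <= sval s x) /\ (sval r y <= sval t y).
        by case: (Atot s t As At) => /asboolP h; [exists t|exists s].
      have := m_le _ (x + y) Ar; have := m_le _ (x - y) Ar.
      by have := qf_parallelogram (sval r) x y; move=> *; lra.
  have mP : admissible m /\ forall x, m x <= q0 x.
    split; last first.
      by move=> x; rewrite (le_trans (m_le _ x As0))//; case: (svalP s0).
    split=> [x|a x]; first by apply: (m_ge) => s As; case: (svalP s) => -[].
    rewrite mulrC -ler_pdivrMr//; apply: (m_ge) => s As.
    rewrite ler_pdivrMr// mulrC (le_trans (m_le _ _ As))//.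
    by case: (svalP s) => -[_ +] _; apply.
  exists (exist _ (QForm mq) mP) => s As; apply/asboolP => x; exact: m_le.
exists q; split=> // kq x.
have nq y : newton_form kq y <= q y.
  by have := conjugate_form_le kq y; rewrite /newton_form => ?; lra.
have nP : admissible (newton_form kq) /\ forall y, newton_form kq y <= q0 y.
  by split=> [|y]; [exact: newton_admissible|rewrite (le_trans (nq y))].
have := qmin (exist _ (QForm (newton_quadratic kq)) nP).
move=> /(_ _)/(congr1 (fun s : T => sval s x)) /= h.
have := h _; rewrite /newton_form => E.
by have := E (asboolT nq) => ?; lra.
Qed.
End Minimal.
End HermitianForms.

(** * Extension of operators and the symmetry of a minimal majorant *)

Section HilbertOperators.
Context {R : realType}.

Lemma Re_hdotxx (U : hilbertType R) (u : U) :
  complex.Re '[<u, u>] = complex.Re `|u| ^+ 2.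
Proof. by rewrite hdotxx Rnorm -rmorphXn. Qed.

Lemma hdot_inj (U : hilbertType R) (u v : U) :
  (forall x, '[<x, u>] = '[<x, v>]) -> u = v.
Proof.
move=> /(_ (u - v)) /eqP; rewrite -subr_eq0 -linearBr => uv.
have /eqP : `|u - v| ^+ 2 = 0 by rewrite -hdotxx; exact/eqP.
by rewrite sqrf_eq0 normr_eq0 subr_eq0 => /eqP.
Qed.

Section TwoSpaces.
Context {U W : hilbertType R}.

Lemma adjointEr (S : bop U W) x y : '[<adjoint S y, x>] = '[<y, S x>].
Proof. by rewrite hdotC -adjointE -hdotC. Qed.

Lemma bop_hdot_eq (S1 S2 : bop U W) :
  (forall x y, '[<S1 x, y>] = '[<S2 x, y>]) -> S1 = S2.
Proof.
move=> h; apply: bop_eqP => x; apply: hdot_inj => y.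
by rewrite hdotC h -hdotC.
Qed.

Lemma bounded_linear_sqr (f : U -> W) (c : R) : 0 <= c -> linear f ->
  (forall u, complex.Re '[<f u, f u>] <= c * complex.Re '[<u, u>]) ->
  f \in @bounded_linear _ U W.
Proof.
move=> c0 fl fc; apply/asboolP; split=> //; exists (Num.sqrt c) => u.
have h1 := Re_norm_ge0 u; have h2 := Re_norm_ge0 (f u).
have h3 : 0 <= Num.sqrt c * complex.Re `|u| by rewrite mulr_ge0 ?sqrtr_ge0.
rewrite (Rnorm u) (Rnorm (f u)) -rmorphM lecR -(@ler_pXn2r _ 2) ?nnegrE//.
by rewrite exprMn sqr_sqrtr// -!Re_hdotxx.
Qed.
End TwoSpaces.

Lemma Re_hdot_sub (U : hilbertType R) (c : R) (u v : U) :
  complex.Re '[<c%:C%C *: u - v, c%:C%C *: u - v>] =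
  c ^+ 2 * complex.Re '[<u, u>] - 2 * c * complex.Re '[<u, v>]
    + complex.Re '[<v, v>].
Proof.
pose k (x y : U) := '[<x, y>].
have kH : hermitian_form k.
  by split=> [z d x y|x y]; [exact: linearPl|exact: hdotC].
rewrite -[LHS]/(complex.Re (k _ _)) (herm_formBl kH).
rewrite !(antilinearB _ _ (form_anti kH _)) !(antilinearZ _ _ (form_anti kH _)).
rewrite -[X in k X u]addr0 -[X in k X v]addr0 !kH.1 (kH.2 v u).
have k0 x : k 0 x = 0 by exact: linear0l.
rewrite !k0 !addr0 /k.
by case: '[<u, u>] '[<u, v>] '[<v, v>] => [a a'] [b b'] [d d'] /=; ring.
Qed.

Lemma hdot_pullback_hermitian (U : hilbertType R) (V : lmodType R[i])
    (w : {linear V -> U}) :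
  hermitian_form (fun x y => '[<w x, w y>]).
Proof.
split=> [z c x y|x y]; last exact: hdotC.
by rewrite linearP linearPl.
Qed.
End HilbertOperators.

Section Representation.
Context {R : realType} {V : lmodType R[i]}.

(** By polarization; the imaginary part of k x y is the real part of k x (iy). *)
Lemma hermitian_form_ext (k1 k2 : V -> V -> R[i]) :
  hermitian_form k1 -> hermitian_form k2 ->
  (forall x, complex.Re (k1 x x) = complex.Re (k2 x x)) -> k1 =2 k2.
Proof.
move=> h1 h2 k12.
have RE x y : complex.Re (k1 x y) = complex.Re (k2 x y).
  have := form_polar h1 x y; have := form_polar h2 x y.
  by rewrite !k12 => *; lra.
have IE (k : V -> V -> R[i]) x y : hermitian_form k ->
    complex.Im (k x y) = complex.Re (k x ('i%C *: y)).
  move=> kH; rewrite (antilinearZ _ _ (form_anti kH x)).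
  by case: (k x y) => a b /=; ring.
by move=> x y; apply: complexP; [|rewrite (IE k1)// (IE k2)//]; exact: RE.
Qed.

(** What the dual is used for: it represents bounded functionals, and V is
    separating and dense in it. *)
Lemma dual_hilbert (q : qform V) :
  exists (K : hilbertType R) (r : {linear dual q -> K}),
  [/\ forall F x, '[<r F, r (emb q x)>] = F x,
      forall F, complex.Re '[<r F, r F>] = dnorm2 F,
      forall u v, (forall x, '[<u, r (emb q x)>] = '[<v, r (emb q x)>]) -> u = v
    & forall u (e : R), 0 < e -> exists x, `|u - r (emb q x)| < e%:C%C].
Proof.
exists (dual q : hilbertType R), (idfun : {linear dual q -> dual q}); split.
- exact: hdot_emb.
- move=> F; rewrite [X in complex.Re X](_ : _ = polar (dqf q) F F)//.
  by rewrite polarxx.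
- exact: dual_dot_eq.
- move=> u e e0; have [x ux] := emb_dense u (exprn_gt0 2 e0).
  exists x; rewrite [X in X < _](_ : _ = dnorm (u - emb q x))//.
  rewrite /dnorm ltcR -(@ltr_pXn2r _ 2) ?nnegrE ?sqrtr_ge0 ?(ltW e0)//.
  by rewrite sqr_sqrtr//; exact: (qf_ge0 (dqf q)).
Qed.
End Representation.

Section Extension.
Context {R : realType} {V : lmodType R[i]} (q : qform V) (K : hilbertType R).
Variable r : {linear dual q -> K}.
Local Notation e x := (r (emb q x)).
Hypothesis rE : forall F x, '[<r F, e x>] = F x.
Hypothesis r_norm : forall F, complex.Re '[<r F, r F>] = dnorm2 F.
Hypothesis e_sep : forall u v, (forall x, '[<u, e x>] = '[<v, e x>]) -> u = v.

Lemma bop_emb_eq (S1 S2 : bop K K) : (forall x, S1 (e x) = S2 (e x)) -> S1 = S2.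
Proof.
move=> h; have E u : adjoint S1 u = adjoint S2 u.
  by apply: e_sep => x; rewrite (adjointEr S1) (adjointEr S2) h.
by apply: bop_hdot_eq => u v; rewrite (adjointE S1) E -(adjointE S2).
Qed.

(** Extension of a bounded map from V to K by duality: u |-> <u, w _> is a
    bounded operator S with values in the dual, and the extension is the adjoint
    of S. *)
Lemma bop_extension (w : {linear V -> K}) (c : R) : 0 < c ->
  (forall x, complex.Re '[<w x, w x>] <= c * q x) ->
  exists S : bop K K, forall x, S (e x) = w x.
Proof.
move=> c0 wc.
have ub u x : 2 * complex.Re '[<u, w x>] - q x <= c * complex.Re '[<u, u>].
  have := sqr_ge0 (complex.Re `|c%:C%C *: u - w x|).
  rewrite -Re_hdotxx Re_hdot_sub.
  have := wc x; set a := complex.Re '[<u, w x>]; set b := complex.Re '[<u, u>].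
  set d := complex.Re _ => wd h.
  have : 0 <= c * (c * b + q x - 2 * a) by lra.
  by rewrite pmulr_rge0// => ?; lra.
have bd u : (fun x => '[<u, w x>] : R[i]^o) \in antibounded q.
  apply/asboolP; split=> [d x y|]; first by rewrite linearP hdotPr.
  by exists (c * complex.Re '[<u, u>]); exact: ub.
pose S u := r (Dual (bd u)).
have SE u x : '[<S u, e x>] = '[<u, w x>] by rewrite rE.
have Sl : linear S.
  move=> d u v; apply: e_sep => x.
  have -> : '[<d *: S u + S v, e x>] = d * '[<S u, e x>] + '[<S v, e x>].
    exact: linearPl.
  by rewrite !SE; exact: linearPl.
have SB : S \in @bounded_linear _ K K.
  apply: (bounded_linear_sqr (ltW c0) Sl) => u.
  by rewrite r_norm; apply: dnorm2_le; exact: ub.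
exists (adjoint (Bop SB)) => x; apply: hdot_inj => u.
by rewrite -adjointE SE.
Qed.

Lemma hdot_e x y : '[<e x, e y>] = polar q x y.
Proof. by rewrite rE. Qed.

Section Symmetry.
Variables (k : V -> V -> R[i]) (kH : hermitian_form k) (kq : dominated k q).
Hypothesis q_selfconj : conjugate_form kH kq =1 q.

(** The extension J of the Gram operator is selfadjoint because k is hermitian,
    and isometric because the conjugate form of [q] is [q]; so J^2 = J^* J = 1. *)
Lemma symmetry_exists : exists J : bop K K,
  [/\ adjoint J = J, J \oB J = bid K & forall x y, '[<J (e x), e y>] = k x y].
Proof.
pose g x := r (gram kH kq x).
have gl : linear g by move=> c x y; rewrite /g !linearP.
pose gL := GRing.isLinear.Build _ _ _ _ g gl.
pose w : {linear V -> K} := HB.pack g gL.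
pose e' x := e x.
have el : linear e' by move=> c x y; rewrite /e' !linearP.
pose eL := GRing.isLinear.Build _ _ _ _ e' el.
pose v : {linear V -> K} := HB.pack e' eL.
have gg x : complex.Re '[<w x, w x>] = q x by rewrite r_norm -[RHS]q_selfconj.
have [|J Je] := @bop_extension w 1 ltr01; first by move=> x; rewrite mul1r gg.
have Jk x y : '[<J (e x), e y>] = k x y by rewrite Je rE.
have Jadj : adjoint J = J.
  apply: bop_emb_eq => x; apply: e_sep => y.
  by rewrite (adjointEr J) hdotC !Jk -kH.2.
exists J; split=> //; apply: bop_emb_eq => x; apply: e_sep => y.
have -> : '[<(J \oB J) (e x), e y>] = '[<w x, w y>].
  by rewrite -!Je; have := adjointE J (J (e x)) (e y); rewrite Jadj.
have := hermitian_form_ext (hdot_pullback_hermitian w) (hdot_pullback_hermitian v).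
by move=> /(_ _ x y) ->// z; rewrite gg hdot_e polarxx.
Qed.
End Symmetry.
End Extension.

(** * Kernels as forms on finitely supported functions *)

Section FiniteSupport.
Context {R : realType} {X : choiceType} {H : hilbertType R}.
Implicit Types (x y : X) (h : H) (K L : X -> X -> bop H H).

Definition fsuppb : {pred X -> H} := fun f => `[< fin_supp f >].

Lemma fsuppb_submod : submod_closed fsuppb.
Proof.
split=> [|c f g /asboolP Ff /asboolP Fg]; apply/asboolP.
  rewrite /fin_supp /= (_ : [set _ | _] = set0)//.
  by apply/seteqP; split=> x //=; rewrite eqxx.
apply: (@sub_finite_set _ _ ([set x | f x != 0] `|` [set x | g x != 0])).
  move=> x /=; rewrite !fctE; have [->|] := eqVneq (f x) 0; last by left.
  by rewrite scaler0 add0r; right.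
by rewrite finite_setU.
Qed.

HB.instance Definition _ := GRing.isSubmodClosed.Build R[i] (X -> H)
  fsuppb fsuppb_submod.

(** The functions of [fin_supp] as a vector space of their own, so that the
    results on forms over an arbitrary vector space apply to them. *)
Record fsupp := FSupp { fsupp_fun :> X -> H; fsuppP : fsupp_fun \in fsuppb }.

HB.instance Definition _ := [isSub for fsupp_fun].
HB.instance Definition _ := [Choice of fsupp by <:].
HB.instance Definition _ := [SubChoice_isSubLmodule of fsupp by <:].

Implicit Types f g : fsupp.

Lemma fsupp_supp f : fin_supp f. Proof. by have /asboolP := fsuppP f. Qed.

Lemma fsupp_ext f g : f =1 g -> f = g.
Proof. by move=> fg; apply/val_inj/funext. Qed.

Definition fsupp_dom f : {fset X} := fset_set [set x | f x != 0].

Lemma fsupp_domP f x : x \notin fsupp_dom f -> f x = 0.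
Proof.
by apply: contraNeq => fx; rewrite in_fset_set ?inE//; exact: fsupp_supp.
Qed.

Lemma pt_subproof x h : point_fun x h \in fsuppb.
Proof.
apply/asboolP; apply: sub_finite_set (finite_set1 x) => y /=.
by rewrite /point_fun; case: (y =P x) => // _; rewrite eqxx.
Qed.
Definition pt x h : fsupp := FSupp (pt_subproof x h).

Lemma pt_linear x : linear (pt x).
Proof.
move=> c h h'; apply: fsupp_ext => y.
rewrite [RHS](_ : _ = c *: pt x h y + pt x h' y)//= /point_fun.
case: (y =P x) => // _.
by rewrite scaler0 addr0.
Qed.
HB.instance Definition _ x :=
  GRing.isLinear.Build R[i] H fsupp _ (pt x) (pt_linear x).

Lemma fsupp_val_sum (I : Type) (r : seq I) (F : I -> fsupp) :
  (\sum_(i <- r) F i : fsupp) = \sum_(i <- r) (F i : X -> H) :> (X -> H).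
Proof. exact: (raddf_sum (\val : fsupp -> X -> H)). Qed.

Lemma fsupp_sumE f : f = \sum_(x <- fsupp_dom f) pt x (f x).
Proof.
apply: fsupp_ext => y; rewrite fsupp_val_sum fct_sumE /= /point_fun.
have [yf|yf] := boolP (y \in fsupp_dom f); last first.
  rewrite fsupp_domP// big_seq big1// => x xf; case: eqP => // yx.
  by rewrite yx xf in yf.
rewrite (bigD1_seq y)//= eqxx big1 ?addr0// => x xy.
by rewrite eq_sym (negPf xy).
Qed.

(** Additive identities on V need only be checked on functions supported at one
    point. *)
Lemma fsupp_ind (P : fsupp -> Prop) :
  P 0 -> (forall f g, P f -> P g -> P (f + g)) -> (forall x h, P (pt x h)) ->
  forall f, P f.
Proof. by move=> P0 PD Pp f; rewrite (fsupp_sumE f); elim/big_ind: _. Qed.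

(** A common finite set D for both functions turns the two sums with variable
    supports into ordinary finite sums. *)
Lemma kform_finE K (D : {fset X}) (f g : X -> H) :
  (forall x, x \notin D -> f x = 0) -> (forall x, x \notin D -> g x = 0) ->
  kform K f g = \sum_(x <- D) \sum_(y <- D) '[<K x y (f y), g x>].
Proof.
move=> fD gD; rewrite /kform (fsbigTE D); last first.
  move=> x xD; rewrite gD// (fsbigTE D) => [|y yD]; last by rewrite linear0r.
  by rewrite big1// => y _; rewrite linear0r.
apply: eq_bigr => x _; apply: fsbigTE => y yD.
by rewrite fD// linear0 linear0l.
Qed.

Lemma kform_linear K f g (h : fsupp) c :
  kform K (c *: f + g : fsupp) h = c * kform K f h + kform K g h.
Proof.
pose D := (fsupp_dom f `|` fsupp_dom g `|` fsupp_dom h)%fset.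
have fD x : x \notin D -> f x = 0.
  by rewrite !inE !negb_or => /andP[/andP[? ?] ?]; exact: fsupp_domP.
have gD x : x \notin D -> g x = 0.
  by rewrite !inE !negb_or => /andP[/andP[? ?] ?]; exact: fsupp_domP.
have hD x : x \notin D -> h x = 0.
  by rewrite !inE !negb_or => /andP[/andP[? ?] ?]; exact: fsupp_domP.
rewrite !(@kform_finE _ D)//; last first.
  move=> x xD; rewrite [LHS](_ : _ = c *: f x + g x)//.
  by rewrite fD// gD// scaler0 addr0.
rewrite mulr_sumr -big_split; apply: eq_bigr => x _ /=.
rewrite mulr_sumr -big_split; apply: eq_bigr => y _ /=.
rewrite -linearPl -linearP; congr ('[<K x y _, h x>]).
Qed.

Lemma kform_herm K f g : hermitian_kernel K -> kform K f g = (kform K g f)^*.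
Proof.
move=> hK; pose D := (fsupp_dom f `|` fsupp_dom g)%fset.
have fD x : x \notin D -> f x = 0.
  by rewrite !inE !negb_or => /andP[? ?]; exact: fsupp_domP.
have gD x : x \notin D -> g x = 0.
  by rewrite !inE !negb_or => /andP[? ?]; exact: fsupp_domP.
rewrite !(@kform_finE _ D)// exchange_big /= rmorph_sum.
apply: eq_bigr => x _ /=.
rewrite rmorph_sum; apply: eq_bigr => y _ /=.
by rewrite -hdotC (hK y x) (adjointEr (K x y)).
Qed.

Lemma kform_hermitian K : hermitian_kernel K ->
  hermitian_form (fun f g : fsupp => kform K f g).
Proof.
by move=> hK; split=> [h c f g|f g]; [exact: kform_linear|exact: kform_herm].
Qed.

Lemma kform_pt K x y h h' : kform K (pt x h) (pt y h') = '[<K y x h, h'>].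
Proof.
rewrite (@kform_finE _ [fset x; y]%fset).
- have [->|xy] := eqVneq x y.
    by rewrite fsetUid !big_seq_fset1 /= /point_fun eqxx.
  have xyN : x \notin [fset y]%fset by rewrite inE.
  have yx : (y == x) = false by rewrite eq_sym (negPf xy).
  rewrite big_fsetU1//= big_seq_fset1 !big_fsetU1//= !big_seq_fset1.
  by rewrite /point_fun !eqxx (negPf xy) yx !linear0 linear0l !add0r addr0.
- by move=> z; rewrite !inE negb_or /= /point_fun => /andP[/negPf-> _].
- by move=> z; rewrite !inE negb_or /= /point_fun => /andP[_ /negPf->].
Qed.

Lemma kformN K f g : kform (fun x y => - K x y) f g = - kform K f g.
Proof.
pose D := (fsupp_dom f `|` fsupp_dom g)%fset.
have fD x : x \notin D -> f x = 0.
  by rewrite !inE !negb_or => /andP[? ?]; exact: fsupp_domP.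
have gD x : x \notin D -> g x = 0.
  by rewrite !inE !negb_or => /andP[? ?]; exact: fsupp_domP.
rewrite !(@kform_finE _ D)// -sumrN; apply: eq_bigr => x _.
by rewrite -sumrN; apply: eq_bigr => y _; rewrite -linearNl.
Qed.

Section Action.
Variables (S : Type) (phi : S -> X -> X).

Lemma psi_subproof a f : psi phi a f \in fsuppb.
Proof.
rewrite (psi_finE _ _ (@fsupp_domP f)); apply: rpred_sum => x _.
exact: pt_subproof.
Qed.
Definition act a f : fsupp := FSupp (psi_subproof a f).

Lemma act_linear a : linear (act a).
Proof.
move=> c f g; apply: fsupp_ext => x.
by rewrite /= psi_linear//; exact: fsupp_supp.
Qed.
HB.instance Definition _ a :=
  GRing.isLinear.Build R[i] fsupp fsupp _ (act a) (act_linear a).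

Lemma act_pt a x h : act a (pt x h) = pt (phi a x) h.
Proof. by apply: fsupp_ext => y; rewrite /= psi_point. Qed.
End Action.
End FiniteSupport.
Arguments fsupp {R} X H.

(** * From a dilation to a majorant *)

Section RealForms.
Context {R : realType}.

Lemma form_quadratic (V : lmodType R[i]) (k : V -> V -> R[i]) :
  hermitian_form k -> (forall x, 0 <= complex.Re (k x x)) ->
  quadratic (fun x => complex.Re (k x x)).
Proof.
move=> kH k0; split=> // [c x|x y].
  rewrite (antilinearZ _ _ (form_anti kH _)) -[X in k X x]addr0 kH.1.
  have -> : k 0 x = 0 by have := herm_formBl kH 0 0 x; rewrite !subrr.
  rewrite le_eqVlt; apply/orP; left; apply/eqP.
  by case: (c) (k x x) => [a b] [d e] /=; rewrite /nsq /=; ring.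
rewrite (herm_formBl kH) (herm_formDl kH) !(antilinearB _ _ (form_anti kH _)).
by rewrite !(antilinearD _ _ (form_anti kH _)) !(ReD, ReN); lra.
Qed.

Lemma selfconj_Im0 (z : R[i]) : z = z^* -> complex.Im z = 0.
Proof.
by move=> /(congr1 (@complex.Im _)); rewrite complex_Im_conj => ?; lra.
Qed.

Lemma selfconj_le (z w : R[i]) : z = z^* -> w = w^* ->
  (z <= w) = (complex.Re z <= complex.Re w).
Proof.
by move=> /selfconj_Im0 z0 /selfconj_Im0 w0; rewrite lecE z0 w0 eqxx.
Qed.

Lemma sqrtC_le_sqr (z w : R[i]) (c : R) : 0 <= z -> 0 <= w ->
  sqrtC z <= c%:C%C * sqrtC w -> complex.Re z <= c ^+ 2 * complex.Re w.
Proof.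
move=> z0 w0 h; have s0 : 0 <= sqrtC z by rewrite sqrtC_ge0.
have : sqrtC z ^+ 2 <= (c%:C%C * sqrtC w) ^+ 2.
  by rewrite ler_pXn2r ?nnegrE// (le_trans s0).
rewrite exprMn !sqrtCK -rmorphXn lecE => /andP[_]; rewrite ReZ.
by [].
Qed.
End RealForms.

Section KernelMap.
Context {R : realType} {X : choiceType} {H K : hilbertType R}.
Variable v : X -> bop H K.

Definition kernel_map (f : fsupp X H) : K := \sum_(x \in [set: X]) v x (f x).

Lemma kernel_map_finE (f : fsupp X H) (D : {fset X}) :
  (forall x, x \notin D -> f x = 0) -> kernel_map f = \sum_(x <- D) v x (f x).
Proof. by move=> fD; apply: fsbigTE => x xD; rewrite fD// linear0. Qed.

Lemma kernel_map_linear : linear kernel_map.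
Proof.
move=> c f g; pose D := (fsupp_dom f `|` fsupp_dom g)%fset.
have fD x : x \notin D -> f x = 0.
  by rewrite !inE !negb_or => /andP[? ?]; exact: fsupp_domP.
have gD x : x \notin D -> g x = 0.
  by rewrite !inE !negb_or => /andP[? ?]; exact: fsupp_domP.
rewrite !(@kernel_map_finE _ D)//; last first.
  move=> x xD; rewrite [LHS](_ : _ = c *: f x + g x)//.
  by rewrite fD// gD// scaler0 addr0.
rewrite scaler_sumr -big_split; apply: eq_bigr => x _ /=.
by rewrite -linearP.
Qed.
HB.instance Definition _ := GRing.isLinear.Build R[i] (fsupp X H) K _
  kernel_map kernel_map_linear.

Lemma kernel_map_pt x h : kernel_map (pt x h) = v x h.
Proof.
rewrite (@kernel_map_finE _ [fset x]%fset).
  by rewrite big_seq_fset1 /= /point_fun eqxx.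
by move=> y; rewrite inE /= /point_fun => /negPf ->.
Qed.

Lemma fsupp_form_ext (k1 k2 : fsupp X H -> fsupp X H -> R[i]) :
  hermitian_form k1 -> hermitian_form k2 ->
  (forall x y h h', k1 (pt x h) (pt y h') = k2 (pt x h) (pt y h')) -> k1 =2 k2.
Proof.
move=> h1 h2 k12 f g.
have k0l (k : fsupp X H -> fsupp X H -> R[i]) z : hermitian_form k -> k 0 z = 0.
  by move=> kH; have := herm_formBl kH 0 0 z; rewrite !subrr.
move: f; apply: fsupp_ind => [|f f' IH IH'|x h].
- by rewrite (k0l k1)// (k0l k2).
- by rewrite (herm_formDl h1) (herm_formDl h2) IH IH'.
move: g; apply: fsupp_ind => [|g g' IH IH'|y h'] //.
- by rewrite (antilinear0 (form_anti h1 _)) (antilinear0 (form_anti h2 _)).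
- rewrite (antilinearD _ _ (form_anti h1 _)) (antilinearD _ _ (form_anti h2 _)).
  by rewrite IH IH'.
Qed.

(** Both sides are hermitian forms, so it is enough to compare them on functions
    supported at one point. *)
Lemma kform_factor (L : X -> X -> bop H H) (G : bop K K) :
  hermitian_kernel L -> adjoint G = G ->
  (forall x y h h', '[<L y x h, h'>] = '[<G (v x h), v y h'>]) ->
  forall f g : fsupp X H, kform L f g = '[<G (kernel_map f), kernel_map g>].
Proof.
move=> hL hG LE; apply: fsupp_form_ext; first exact: kform_hermitian.
  split=> [z c x y|x y]; last by rewrite hdotC -(adjointEr G) hG.
  by rewrite !linearP linearPl.
by move=> x y h h'; rewrite kform_pt LE !kernel_map_pt.
Qed.
End KernelMap.

Section DilationToMajorant.
Context {R : realType} {A : starAlgType R} {H : hilbertType R}.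

Lemma fsymKE (K : kreinSpace R) (u : K) : Defs.fsym K (Defs.fsym K u) = u.
Proof. by have := congr1 (fun S : bop K K => S u) (Defs.fsymK K). Qed.

(** Cauchy-Schwarz and the fact that a symmetry preserves the norm. *)
Lemma Re_fsym_le (K : kreinSpace R) (u : K) :
  `|complex.Re '[<Defs.fsym K u, u>]| <= complex.Re '[<u, u>].
Proof.
have n2 : complex.Re `|Defs.fsym K u| = complex.Re `|u|.
  apply/eqP; rewrite -(@eqrXn2 _ 2) ?Re_norm_ge0// -!Re_hdotxx.
  by rewrite adjointE (fsym_adj K) fsymKE.
have h1 := Re_hdot_le (Defs.fsym K u) u.
have h2 := Re_hdot_le (- Defs.fsym K u) u.
rewrite ler_norml Re_hdotxx expr2 -{1}n2; rewrite n2 in h1.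
rewrite normrN n2 linearNl ReN in h2.
by rewrite n2; apply/andP; split; lra.
Qed.

(** The factorizations T(x y') = V_x^* J V_y and L(x, y) = V_x^* V_y, where
    V_x = pi(x') B; see [kform_factor]. *)
Lemma majorant_of_dilation (T : {linear A -> bop H H}) (hT : hermitian_map T)
    (K : kreinSpace R) (pi : A -> bop K K) (B : bop H K) :
  stinespring_dilation T pi B ->
  exists2 L : A -> A -> bop H H, Bphi_plus (fun a x : A => x * star a) L &
    kernel_le (fun x y => - L x y) (fun x y : A => T (x * star y)) /\
    kernel_le (fun x y : A => T (x * star y)) L.
Proof.
move=> [[piL piM piS] TE].
pose v x := pi (star x) \oB B.
pose L x y : bop H H := adjoint (v x) \oB v y.
pose KT := fun x y : A => T (x * star y).
have KTh : hermitian_kernel KT.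
  by move=> x y; rewrite /KT -hT starM starK.
have Lv x y h h' : '[<L x y h, h'>] = '[<v y h, v x h'>] by exact: adjointEr.
have Lh : hermitian_kernel L.
  move=> x y; apply: bop_hdot_eq => h h'.
  by rewrite (adjointEr (L y x)) Lv (hdotC h) Lv -hdotC.
have idA : adjoint (bid K) = bid K.
  by apply: bop_hdot_eq => u w; rewrite adjointEr.
pose w := kernel_map v.
have LE (f g : fsupp A H) : kform L f g = '[<w f, w g>].
  apply: (kform_factor (G := bid K)) => // x y h h'; exact: Lv.
have KTE (f g : fsupp A H) : kform KT f g = '[<Defs.fsym K (w f), w g>].
  apply: kform_factor => //; first exact: fsym_adj.
  move=> x y h h'; rewrite /KT TE piM.
  have -> : '[<(adjoint B \oB Defs.fsym K \oB (pi y \oB pi (star x)) \oB B) h, h'>]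
    = '[<Defs.fsym K (pi y (v x h)), B h'>] by exact: adjointEr.
  rewrite -[y in pi y](starK y) piS.
  have -> : Defs.fsym K (sharp (pi (star y)) (v x h)) =
      adjoint (pi (star y)) (Defs.fsym K (v x h)).
    exact: fsymKE.
  exact: adjointEr.
have wpsi a f : w (act (fun a x : A => x * star a) a f) = pi a (w f).
  rewrite /w; move: f; apply: fsupp_ind => [|f g IH IH'|x h].
  - by rewrite !linear0.
  - by rewrite !linearD /= IH IH'.
  by rewrite act_pt !kernel_map_pt /v starM starK piM.
have wn (f : fsupp A H) : 0 <= kform L f f by rewrite LE hdotxx exprn_ge0.
exists L; first split.
- split=> // f Ff; exact: (wn (FSupp (asboolT Ff))).
- move=> a; have [M piM'] := bop_bounded (pi a); exists M => f Ff.
  pose f' := FSupp (asboolT Ff).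
  have -> : kform L f f = '[<w f', w f'>] by exact: (LE f' f').
  have -> : kform L (psi (fun a x : A => x * star a) a f)
      (psi (fun a x : A => x * star a) a f) = '[<pi a (w f'), pi a (w f')>].
    by rewrite -wpsi -LE.
  by rewrite !hdotxx !sqrCK.
split=> f Ff; pose f' := FSupp (asboolT Ff).
  rewrite (kformN L f' f') [leRHS](KTE f' f') LE.
  have h := Re_fsym_le (w f'); rewrite selfconj_le.
  - by rewrite ReN; move: h; rewrite ler_norml => /andP[? _].
  - by rewrite rmorphN /= -hdotC.
  - by rewrite -KTE -kform_herm.
rewrite [leRHS](LE f' f') [leLHS](KTE f' f').
have h := Re_fsym_le (w f'); rewrite selfconj_le.
- by move: h; rewrite ler_norml => /andP[_ ?].
- by rewrite -KTE -kform_herm.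
- by rewrite -hdotC.
Qed.
End DilationToMajorant.

(** * From a majorant to a dilation *)

Lemma fsupp_adjoint (R : realType) (X : choiceType) (H : hilbertType R)
    (k : fsupp X H -> fsupp X H -> R[i]) (S S' : fsupp X H -> fsupp X H) :
  hermitian_form k -> linear S -> linear S' ->
  (forall x y h h', k (S (pt x h)) (pt y h') = k (pt x h) (S' (pt y h'))) ->
  forall f g, k (S f) g = k f (S' g).
Proof.
move=> kH Sl S'l Spt f g.
have lin0 (P : fsupp X H -> fsupp X H) : linear P -> P 0 = 0.
  by move=> /(_ (-1) 0 0); rewrite scaler0 addr0 scaleN1r addNr.
have linD (P : fsupp X H -> fsupp X H) x y : linear P -> P (x + y) = P x + P y.
  by move=> /(_ 1 x y); rewrite !scale1r.
have Z z : k 0 z = 0 by have := herm_formBl kH 0 0 z; rewrite !subrr.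
move: f; apply: fsupp_ind => [|f f' IH IH'|x h].
- by rewrite lin0// !Z.
- by rewrite linD// !(herm_formDl kH) IH IH'.
move: g; apply: fsupp_ind => [|g g' IH IH'|y h'] //.
- by rewrite lin0// !(antilinear0 (form_anti kH _)).
- by rewrite linD// !(antilinearD _ _ (form_anti kH _)) IH IH'.
Qed.

Section MajorantToDilation.
Context {R : realType} {A : starAlgType R} {H : hilbertType R}.
Variables (T : {linear A -> bop H H}) (hT : hermitian_map T).

Let phi := fun a x : A => x * star a.
Let KT := fun x y : A => T (x * star y).
Local Notation act := (act phi).
Local Notation k := (fun f g : fsupp A H => kform KT f g).

Lemma kernel_of_map_hermitian : hermitian_kernel KT.
Proof. by move=> x y; rewrite /KT -hT starM starK. Qed.

Let kH : hermitian_form k := kform_hermitian kernel_of_map_hermitian.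

(** At points x and y, both sides come from the value T(y a x') of T. *)
Lemma act_adjoint a (f g : fsupp A H) :
  kform KT (act a f) g = kform KT f (act (star a) g).
Proof.
apply: (fsupp_adjoint kH (act_linear phi a) (act_linear phi (star a))) => x y h h'.
by rewrite !act_pt !kform_pt /KT /phi starM !starK mulrA.
Qed.

Variables (L : A -> A -> bop H H) (LB : Bphi_plus phi L).
Hypotheses (LK : kernel_le (fun x y => - L x y) KT) (KL : kernel_le KT L).

(** The constants are symmetrized over a and a', as [minimal_form] requires; the
    summand 1 keeps them positive. *)
Lemma majorant_form : exists (q0 : qform (fsupp A H)) (c : A -> R),
  [/\ forall a, 0 < c a, forall a, c (star a) = c a,
      admissible k act c q0
    & forall h, q0 (pt 1 h) = complex.Re '[<L 1 1 h, h>]].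
Proof.
have [[Lh Lp] Lb] := LB; have LH := kform_hermitian Lh.
have Lpos (f : fsupp A H) : 0 <= kform L f f := Lp _ (fsupp_supp f).
have Lq : quadratic (fun f : fsupp A H => complex.Re (kform L f f)).
  by apply: (form_quadratic LH) => f; have := Lpos f; rewrite lecE => /andP[].
have /choice[d dP] : forall a, exists d : R, forall f : fsupp A H,
    complex.Re (kform L (act a f) (act a f)) <= d ^+ 2 * complex.Re (kform L f f).
  move=> a; have [d dP] := Lb a; exists d => f.
  apply: sqrtC_le_sqr; [exact: Lpos|exact: Lpos|].
  exact: dP _ (fsupp_supp f).
exists (QForm Lq), (fun a => d a ^+ 2 + d (star a) ^+ 2 + 1); split.
- by move=> a; rewrite ltr_wpDl// addr_ge0 ?sqr_ge0.
- by move=> a; rewrite starK (addrC (d a ^+ 2)).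
- split=> [f|a f] /=.
    have := LK (fsupp_supp f); rewrite kformN lecE ReN => /andP[_ h1].
    have := KL (fsupp_supp f); rewrite lecE => /andP[_ h2].
    by rewrite ler_norml h1 h2.
  have f0 : 0 <= complex.Re (kform L f f) by have := Lpos f; rewrite lecE => /andP[].
  rewrite (le_trans (dP a f))// ler_wpM2r// -addrA lerDl.
  by rewrite addr_ge0 ?sqr_ge0.
- by move=> h; rewrite /= kform_pt.
Qed.

Lemma dilation_of_majorant :
  exists (K : kreinSpace R) (pi : A -> bop K K) (B : bop H K),
     stinespring_dilation T pi B /\ minimal_dilation pi B.
Proof.
have [q0 [c [c0 cstar q0A q01]]] := majorant_form.
have [q [[kq qc] qq0 /(_ kq) qconj]] := minimal_form kH act_adjoint c0 cstar q0A.
have [K [r [rE rn esep dense]]] := dual_hilbert q.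
have [J [Jadj JJ Jk]] := symmetry_exists rE rn esep qconj.
have JJE u : J (J u) = u by have := congr1 (fun S : bop K K => S u) JJ.
pose e (f : fsupp A H) := r (emb q f).
have eD f g : e (f + g) = e f + e g by rewrite /e !linearD.
have eZ d f : e (d *: f) = d *: e f by rewrite /e !linearZ.
have en f : complex.Re '[<e f, e f>] = q f by rewrite rn dnorm2_emb.
(* pi a extends psi_a to K *)
have /choice[pi piE] : forall a, exists S : bop K K, forall f, S (e f) = e (act a f).
  move=> a; pose w f := e (act a f).
  have wl : linear w by move=> d f g; rewrite /w linearP eD eZ.
  pose wL := GRing.isLinear.Build _ _ _ _ w wl.
  pose w' : {linear fsupp A H -> K} := HB.pack w wL.
  apply: (bop_extension rE rn esep (w := w') (c0 a)) => f.
  by rewrite en; exact: qc.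
have bop_eq (S1 S2 : bop K K) : (forall f, S1 (e f) = S2 (e f)) -> S1 = S2.
  exact: (bop_emb_eq esep).
pose b h := e (pt 1 h).
have bl : linear b by move=> d h h'; rewrite /b linearP eD eZ.
have [M LM] := bop_bounded (L 1 1).
have bB : b \in @bounded_linear _ H K.
  apply: (bounded_linear_sqr (normr_ge0 M) bl) => h.
  rewrite en (le_trans (qq0 _))// q01 (le_trans (Re_hdot_le _ _))//.
  rewrite Re_hdotxx expr2 mulrA ler_wpM2r ?Re_norm_ge0//.
  rewrite -lecR real_complexM -!Rnorm (le_trans (LM h))//.
  by rewrite ler_wpM2r// lecR ler_norm.
pose KS : kreinSpace R :=
  @KreinSpace R K (fun u v => '[<J u, v>]) J Jadj JJ (fun u v => erefl).
have Jinj u v : J u = J v -> u = v by move=> /(congr1 J); rewrite !JJE.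
(* the class of a one-point function depends antilinearly on the point because k
   does, and the Gram operator J is injective; this is what makes pi linear *)
have pt_anti d x y h : e (pt (d *: x + y) h) = d^* *: e (pt x h) + e (pt y h).
  have JP u v z : '[<J (d^* *: u + v), z>] = d^* * '[<J u, z>] + '[<J v, z>].
    by rewrite linearP; exact: linearPl.
  apply: Jinj; apply: esep => g; rewrite JP !Jk.
  move: g; apply: fsupp_ind => [|g g' IH IH'|z h'].
  - by rewrite !(antilinear0 (form_anti kH _)) mulr0 addr0.
  - by rewrite !(antilinearD _ _ (form_anti kH _)) IH IH'; ring.
  rewrite !kform_pt /KT starP mulrDr -scalerAr linearP.
  exact: linearPl.
exists KS, pi, (Bop bB : bop H KS); split; first split; first split.
- move=> d a a'; apply: bop_eq => f.
  have -> : (d *: pi a + pi a') (e f) = d *: pi a (e f) + pi a' (e f) by [].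
  rewrite !piE; move: f; apply: fsupp_ind => [|f g IH IH'|x h].
  - by rewrite !linear0 /e !linear0 addr0.
  - by rewrite !linearD /= !eD IH IH' scalerDr addrACA.
  by rewrite !act_pt /phi starP mulrDr -scalerAr pt_anti conjCK.
- move=> a a'; apply: bop_eq => f; rewrite piE.
  have -> : (pi a \oB pi a') (e f) = pi a (pi a' (e f)) by [].
  rewrite !piE; congr e; move: f; apply: fsupp_ind => [|f g IH IH'|x h].
  - by rewrite !linear0.
  - by rewrite !linearD /= IH IH'.
  by rewrite !act_pt /phi starM mulrA.
- move=> a; apply: bop_eq => f; rewrite piE.
  have -> : sharp (pi a : bop KS KS) (e f) = J (adjoint (pi a) (J (e f))) by [].
  apply: Jinj; rewrite JJE; apply: esep => g.
  by rewrite (adjointEr (pi a)) -[r _]/(e g) piE !Jk act_adjoint starK.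
- move=> a; apply: bop_hdot_eq => h h'.
  have -> : '[<(adjoint (Bop bB : bop H KS) \oB Defs.fsym KS \oB pi a \oB Bop bB) h, h'>]
    = '[<J (pi a (b h)), b h'>] by exact: adjointEr.
  by rewrite piE Jk act_pt kform_pt /KT /phi !mul1r starK.
move=> O [u Ou] oO; have := open_nbhs_nbhs (conj oO Ou).
rewrite -nbhs_ballE => -[eps /= eps0 ballO].
have [s s0 sE] : exists2 s : R, 0 < s & eps = s%:C%C.
  have er : eps \is Num.real by rewrite gtr0_real.
  by exists (complex.Re eps); [rewrite -ltr0c RRe_real|rewrite RRe_real].
have [f fu] := dense u _ s0; exists (e f); split.
  by apply: ballO; rewrite -ball_normE /= sE.
(* f is the sum of its one-point parts; the part with value h at x has the
   class pi x' (B h) *)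
pose s' := fsupp_dom f : seq A.
exists (size s'), (fun=> 1), (fun i => e (pt (nth 0 s' i) (f (nth 0 s' i)))); split.
  move=> i; exists (star (nth 0 s' i)) => //; exists (f (nth 0 s' i)) => //=.
  by rewrite piE act_pt /phi starK mul1r.
rewrite /e {1}(fsupp_sumE f) !linear_sum /= (big_nth 0) big_mkord.
by apply: eq_bigr => i _; rewrite scale1r.
Qed.
End MajorantToDilation.

Theorem theorem4p2 (R : realType) (A : starAlgType R) (H : hilbertType R)
    (T : {linear A -> bop H H}) (hT : hermitian_map T) :
  let KT := fun x y : A => T (x * star y) in
  let phi := fun a x : A => x * star a in
  (exists2 L : A -> A -> bop H H, Bphi_plus phi L &
     kernel_le (fun x y => - L x y) KT /\ kernel_le KT L) <->
  (exists (K : kreinSpace R) (pi : A -> bop K K) (B : bop H K),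
     stinespring_dilation T pi B /\ minimal_dilation pi B).
Proof.
move=> KT phi; split.
  by move=> [L LB [LK KL]]; exact: (dilation_of_majorant hT LB LK KL).
by move=> [K [pi [B [TB _]]]]; exact: (majorant_of_dilation hT TB).
Qed.
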